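(* Let $R$ be a commutative ring with identity and let $M$ be an $R$-module such that every $R$-weakly proregular sequence is an $M$-weakly proregular sequence. Then the trivial extension $R\ltimes M$ is a Cohen-Macaulay ring (that is, Cohen-Macaulay as a module over itself) if and only if $R$ is Cohen-Macaulay (as a module over itself) and every $R$-regular sequence is a weak $M$-regular sequence.
   Context: All rings are commutative with identity and all modules are unital; sequences are finite sequences of ring elements, and $\ell(\mathbf{x})$ is the length of $\mathbf{x}$. Trivial extension: $R\ltimes M$ is the ring with additive group $R\oplus M$ and multiplication $(r,m)(s,n)=(rs,rn+sm)$. Regular sequences: for a ring $A$ and an $A$-module $N$, a sequence $\mathbf{x}=x_1,\ldots,x_\ell$ in $A$ is weak $N$-regular if $x_i$ is a non-zero-divisor on $N/(x_1,\ldots,x_{i-1})N$ for $i=1,\ldots,\ell$; it is $N$-regular if in addition $N\neq\mathbf{x}N$. The empty sequence is regarded as an $N$-regular sequence of length zero for every $N$. Weakly proregular sequences: let $\mathbb{K}_\bullet(x,N)$ be the Koszul complex $0\to N\xrightarrow{x}N\to 0$ (degrees $1,0$), and $\mathbb{K}_\bullet(\mathbf{x},N)=\mathbb{K}_\bullet(x_1,A)\otimes_A\cdots\otimes_A\mathbb{K}_\bullet(x_\ell,A)\otimes_A N$ with homology $H_i(\mathbf{x},N)$. Write $\mathbf{x}^m=x_1^m,\ldots,x_\ell^m$. For $m\ge n$ let $\phi^m_n(\mathbf{x},N):\mathbb{K}_\bullet(\mathbf{x}^m,N)\to\mathbb{K}_\bullet(\mathbf{x}^n,N)$ be the chain map obtained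 by tensoring the maps $\mathbb{K}_\bullet(x_j^m,A)\to\mathbb{K}_\bullet(x_j^n,A)$ that are multiplication by $x_j^{m-n}$ in degree $1$ and the identity in degree $0$. The sequence $\mathbf{x}$ is $N$-weakly proregular if for each $n$ there is $m\ge n$ such that the induced map $H_i(\mathbf{x}^m,N)\to H_i(\mathbf{x}^n,N)$ is zero for all $i\ge1$. Čech cohomology: $C(x)$ is the complex $0\to A\to A_x\to0$ (degrees $0,1$, natural localization map), $C(\mathbf{x})=C(x_1)\otimes_A\cdots\otimes_A C(x_\ell)$, and $H^i_{\mathbf{x}}(N)$ is the $i$th cohomology of $C(\mathbf{x})\otimes_A N$. Parameter sequences: $\mathbf{x}$ is a parameter sequence on $N$ if (1) $\mathbf{x}$ is $N$-weakly proregular, (2) $\mathbf{x}N\ne N$, (3) $H^{\ell(\mathbf{x})}_{\mathbf{x}}(N)_{\mathfrak{p}}\neq0$ for all primes $\mathfrak{p}\in\operatorname{Supp}_A(N/\mathbf{x}N)$. It is a strong parameter sequence on $N$ if $x_1,\ldots,x_i$ is a parameter sequence on $N$ for every $i=1,\ldots,\ell(\mathbf{x})$. The empty sequence is considered a parameter sequence of length zero on any module. Cohen-Macaulay: an $A$-module $N$ is Cohen-Macaulay if every strong parameter sequence on $N$ is an $N$-regular sequence. A ring is Cohen-Macaulay if it is so as a module over itself. *)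

(* Defs.v *)
From HB Require Import structures.
From mathcomp Require Import all_boot all_algebra.
From mathcomp Require Import ring.
From mathcomp Require Import boolp.

Set Implicit Arguments.
Unset Strict Implicit.
Unset Printing Implicit Defensive.

Import GRing.Theory.
Local Open Scope ring_scope.
Local Open Scope quotient_scope.

Definition linear_of (A : comPzRingType) (U V : lmodType A) (f : U -> V)
    (fL : linear f) : {linear U -> V} :=
  HB.pack f (GRing.isLinear.Build A U V *:%R f fL).

Definition trivial_extension (R : comPzRingType) (M : lmodType R) : Type :=
  (R * M)%type.

Notation "R ⋉ M" := (@trivial_extension R M) (at level 40).

Section TrivialExtension.
Variables (R : comPzRingType) (M : lmodType R).
Implicit Types a b c : R ⋉ M.

HB.instance Definition _ := GRing.Zmodule.copy (R ⋉ M) (R * M)%type.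

Definition te_one : R ⋉ M := (1, 0).
Definition te_mul a b : R ⋉ M := (a.1 * b.1, a.1 *: b.2 + b.1 *: a.2).

Fact te_mulA : associative te_mul.
Proof.
move=> a b c; congr pair; rewrite /= ?mulrA //.
by rewrite !scalerDr !scalerA addrA [c.1 * a.1]mulrC [c.1 * b.1]mulrC [_ * c.1]mulrC.
Qed.

Fact te_mulC : commutative te_mul.
Proof. by move=> a b; congr pair; rewrite 1?mulrC // addrC. Qed.

Fact te_mul1 : left_id te_one te_mul.
Proof. by case=> r m; congr pair; rewrite /= ?mul1r // scale1r scaler0 addr0. Qed.

Fact te_mulDl : left_distributive te_mul +%R.
Proof.
move=> a b c; congr pair; rewrite /= ?mulrDl //.
by rewrite scalerDl scalerDr addrACA.
Qed.

HB.instance Definition _ :=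
  GRing.Zmodule_isComPzRing.Build (R ⋉ M) te_mulA te_mulC te_mul1 te_mulDl.
End TrivialExtension.

Definition submod_pred (A : comPzRingType) (N : lmodType A) (B : submodClosed N)
  : {pred N} := fun n => n \in B.

Section SubmodPred.
Variables (A : comPzRingType) (N : lmodType A) (B : submodClosed N).
Fact submod_pred_closed : zmod_closed (submod_pred B).
Proof.
split=> [|u v uB vB]; first exact: (rpred0 B).
by rewrite /submod_pred unfold_in -scaleN1r rpredD ?rpredZ.
Qed.
HB.instance Definition _ :=
  GRing.isZmodClosed.Build N (submod_pred B) submod_pred_closed.
End SubmodPred.

Definition quot_mod (A : comPzRingType) (N : lmodType A) (B : submodClosed N)
  : Type := Quotient.quot (submod_pred B).

Section QuotMod.
Variables (A : comPzRingType) (N : lmodType A) (B : submodClosed N).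
Local Notation Q := (quot_mod B).

HB.instance Definition _ := GRing.Zmodule.copy Q (Quotient.quot (submod_pred B)).

Definition quot_pi (n : N) : Q := \pi_(Quotient.quot (submod_pred B)) n.
Definition quot_scale (a : A) (q : Q) : Q :=
  quot_pi (a *: repr (q : Quotient.quot (submod_pred B))).

Lemma quot_repr (q : Q) : quot_pi (repr (q : Quotient.quot (submod_pred B))) = q.
Proof. exact: reprK. Qed.

Lemma quot_pi_eq n n' : quot_pi n = quot_pi n' <-> n - n' \in B.
Proof.
rewrite /quot_pi; split=> [/eqP|h]; first by rewrite -Quotient.idealrBE.
by apply/eqP; rewrite -Quotient.idealrBE.
Qed.

Fact quot_piB : zmod_morphism quot_pi.
Proof. by move=> n n'; rewrite /quot_pi raddfB. Qed.
HB.instance Definition _ := GRing.isZmodMorphism.Build N Q quot_pi quot_piB.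

Lemma quot_scaleE a n : quot_scale a (quot_pi n) = quot_pi (a *: n).
Proof.
by apply/quot_pi_eq; rewrite -scalerBr rpredZ //; apply/quot_pi_eq/quot_repr.
Qed.

Fact quot_scaleA a b q : quot_scale a (quot_scale b q) = quot_scale (a * b) q.
Proof. by rewrite -[q]quot_repr !quot_scaleE scalerA. Qed.
Fact quot_scale1 : left_id 1 quot_scale.
Proof. by move=> q; rewrite -[q]quot_repr quot_scaleE scale1r. Qed.
Fact quot_scaleDr : right_distributive quot_scale +%R.
Proof.
move=> a p q; rewrite -[p]quot_repr -[q]quot_repr -raddfD !quot_scaleE.
by rewrite scalerDr raddfD.
Qed.
Fact quot_scaleDl q : {morph quot_scale^~ q : a b / a + b}.
Proof. by move=> a b; rewrite -[q]quot_repr !quot_scaleE scalerDl raddfD. Qed.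

HB.instance Definition _ := GRing.Zmodule_isLmodule.Build A Q
  quot_scaleA quot_scale1 quot_scaleDr quot_scaleDl.

Fact quot_piZ : scalable quot_pi.
Proof. by move=> a n; rewrite -quot_scaleE. Qed.
HB.instance Definition _ := GRing.isScalable.Build A N Q *:%R quot_pi quot_piZ.
End QuotMod.

Record submod (A : comPzRingType) (N : lmodType A) (Z : submodClosed N) :=
  Submod { submod_val : N; _ : submod_val \in Z }.

Section Submod.
Variables (A : comPzRingType) (N : lmodType A) (Z : submodClosed N).
HB.instance Definition _ := [isSub for @submod_val A N Z].
HB.instance Definition _ := [Choice of submod Z by <:].
HB.instance Definition _ := [SubChoice_isSubLmodule of submod Z by <:].
End Submod.

Definition sub_pred (A : comPzRingType) (N : lmodType A) (Z B : submodClosed N)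
  : {pred submod Z} := fun z => submod_val z \in B.
Arguments sub_pred {A N} Z B.

Section SubPred.
Variables (A : comPzRingType) (N : lmodType A) (Z B : submodClosed N).
Fact sub_pred_closed : submod_closed (sub_pred Z B).
Proof.
split=> [|a u v uB vB]; first exact: (rpred0 B).
have -> : (a *: u + v \in sub_pred Z B) = (a *: val u + val v \in B).
  by rewrite -linearP.
by rewrite rpredD ?rpredZ.
Qed.
HB.instance Definition _ :=
  GRing.isSubmodClosed.Build A (submod Z) (sub_pred Z B) sub_pred_closed.
End SubPred.

(** [subquot Z B] is [Z / (Z ∩ B)]; below [B] is always contained in [Z]. *)
Definition subquot (A : comPzRingType) (N : lmodType A) (Z B : submodClosed N)
  : lmodType A := quot_mod (sub_pred Z B).

Section Localization.
Variables (A : comPzRingType) (S : mulrClosed A).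

Record denom := Denom { denom_val :> A; _ : denom_val \in S }.
HB.instance Definition _ := [isSub for denom_val].
HB.instance Definition _ := [Choice of denom by <:].

Fact denomP (s : denom) : (s : A) \in S. Proof. by case: s. Qed.
Definition denom1 : denom := Denom (rpred1 S).
Definition denomM (s t : denom) : denom :=
  Denom (rpredM (denomP s) (denomP t)).

Variable N : lmodType A.
Implicit Types p q r : (N * denom)%type.

Definition mloc_rel p q : bool :=
  `[< exists u : denom,
      (denom_val u * denom_val q.2) *: p.1 = (denom_val u * denom_val p.2) *: q.1 >].

Fact mloc_rel_equiv : equiv_class_of mloc_rel.
Proof.
split=> [p|p q|q p r].
- by apply/asboolP; exists denom1.
- by apply/asboolP/asboolP => -[u e]; exists u.
- move=> /asboolP[u e] /asboolP[v f]; apply/asboolP.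
  exists (denomM (denomM u v) q.2) => /=.
  move: e f; set a := denom_val u; set b := denom_val v.
  set p2 := denom_val p.2; set q2 := denom_val q.2; set r2 := denom_val r.2.
  move=> e f.
  have -> : a * b * q2 * r2 = b * r2 * (a * q2) by ring.
  rewrite -scalerA e scalerA.
  have -> : b * r2 * (a * p2) = a * p2 * (b * r2) by ring.
  by rewrite -scalerA f scalerA; congr (_ *: _); ring.
Qed.
Canonical mloc_equiv := EquivRelPack mloc_rel_equiv.
Canonical mloc_encModRel := defaultEncModRel mloc_rel.

Definition mloc : Type := {eq_quot mloc_rel}.
HB.instance Definition _ := Choice.copy mloc {eq_quot mloc_rel}.

Definition frac (n : N) (s : denom) : mloc := \pi_({eq_quot mloc_rel}) (n, s).
Definition mloc_repr (x : mloc) : N * denom := repr (x : {eq_quot mloc_rel}).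

Lemma frac_eq n s m t : frac n s = frac m t <->
  exists u : denom,
    (denom_val u * denom_val t) *: n = (denom_val u * denom_val s) *: m.
Proof.
split=> [/eqmodP/asboolP //|e].
by apply/eqmodP/asboolP.
Qed.

Lemma mloc_reprK x : frac (mloc_repr x).1 (mloc_repr x).2 = x.
Proof. by rewrite /frac -surjective_pairing; apply: reprK. Qed.

Lemma mloc_reprP n s : exists u : denom,
  (denom_val u * denom_val s) *: (mloc_repr (frac n s)).1
  = (denom_val u * denom_val (mloc_repr (frac n s)).2) *: n.
Proof. by apply/frac_eq/mloc_reprK. Qed.

Variant mloc_spec : mloc -> Prop := MlocSpec n s : mloc_spec (frac n s).
Lemma mlocP x : mloc_spec x. Proof. by rewrite -[x]mloc_reprK. Qed.

Definition mloc_add (x y : mloc) : mloc :=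
  let p := mloc_repr x in let q := mloc_repr y in
  frac (denom_val q.2 *: p.1 + denom_val p.2 *: q.1) (denomM p.2 q.2).
Definition mloc_scale (a : A) (x : mloc) : mloc :=
  frac (a *: (mloc_repr x).1) (mloc_repr x).2.
Definition mloc_opp (x : mloc) : mloc :=
  frac (- (mloc_repr x).1) (mloc_repr x).2.

Lemma mloc_addE n s m t : mloc_add (frac n s) (frac m t)
  = frac (denom_val t *: n + denom_val s *: m) (denomM s t).
Proof.
have [u e] := mloc_reprP n s; have [v f] := mloc_reprP m t.
apply/frac_eq; exists (denomM u v); move: e f => /=.
set n' := (mloc_repr (frac n s)).1; set m' := (mloc_repr (frac m t)).1.
set a := denom_val u; set b := denom_val v.
set s' := denom_val (mloc_repr (frac n s)).2.
set t' := denom_val (mloc_repr (frac m t)).2.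
set s1 := denom_val s; set t1 := denom_val t => e f.
rewrite !scalerDr !scalerA; congr (_ + _).
  have -> : a * b * (s1 * t1) * t' = b * t1 * t' * (a * s1) by ring.
  by rewrite -scalerA e scalerA; congr (_ *: _); ring.
have -> : a * b * (s1 * t1) * s' = a * s1 * s' * (b * t1) by ring.
by rewrite -scalerA f scalerA; congr (_ *: _); ring.
Qed.

Lemma mloc_scaleE a n s : mloc_scale a (frac n s) = frac (a *: n) s.
Proof.
have [u e] := mloc_reprP n s; apply/frac_eq; exists u.
by rewrite !scalerA ![_ * a]mulrC -scalerA e !scalerA; congr (_ *: _); ring.
Qed.

Lemma mloc_oppE n s : mloc_opp (frac n s) = frac (- n) s.
Proof.
by have [u e] := mloc_reprP n s; apply/frac_eq; exists u; rewrite !scalerN e.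
Qed.

Fact mloc_addA : associative mloc_add.
Proof.
move=> x y z; case: (mlocP x) => n s; case: (mlocP y) => m t.
case: (mlocP z) => k r; rewrite !mloc_addE; apply/frac_eq; exists denom1 => /=.
by rewrite !scalerDr !scalerA addrA; congr (_ *: _ + _ *: _ + _ *: _); ring.
Qed.

Fact mloc_addC : commutative mloc_add.
Proof.
move=> x y; case: (mlocP x) => n s; case: (mlocP y) => m t.
rewrite !mloc_addE; apply/frac_eq; exists denom1 => /=.
by rewrite addrC; congr (_ *: _); ring.
Qed.

Fact mloc_add0 : left_id (frac 0 denom1) mloc_add.
Proof.
move=> x; case: (mlocP x) => n s; rewrite mloc_addE; apply/frac_eq.
by exists denom1 => /=; rewrite scaler0 add0r !scalerA; congr (_ *: _); ring.
Qed.

Fact mloc_addN : left_inverse (frac 0 denom1) mloc_opp mloc_add.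
Proof.
move=> x; case: (mlocP x) => n s; rewrite mloc_oppE mloc_addE; apply/frac_eq.
by exists denom1 => /=; rewrite scalerN addNr !scaler0.
Qed.

HB.instance Definition _ :=
  GRing.isZmodule.Build mloc mloc_addA mloc_addC mloc_add0 mloc_addN.

Lemma frac_add n s m t : frac n s + frac m t
  = frac (denom_val t *: n + denom_val s *: m) (denomM s t).
Proof. exact: mloc_addE. Qed.

Lemma fracD s : {morph frac^~ s : n m / n + m}.
Proof.
move=> n m; rewrite frac_add; apply/frac_eq; exists denom1 => /=.
by rewrite !scalerDr !scalerA; congr (_ *: _ + _ *: _); ring.
Qed.

Fact mloc_scaleA a b x : mloc_scale a (mloc_scale b x) = mloc_scale (a * b) x.
Proof. by case: (mlocP x) => n s; rewrite !mloc_scaleE scalerA. Qed.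
Fact mloc_scale1 : left_id 1 mloc_scale.
Proof. by move=> x; case: (mlocP x) => n s; rewrite mloc_scaleE scale1r. Qed.
Fact mloc_scaleDr : right_distributive mloc_scale +%R.
Proof.
move=> a x y; case: (mlocP x) => n s; case: (mlocP y) => m t.
rewrite frac_add !mloc_scaleE frac_add; congr frac.
by rewrite scalerDr !scalerA [a * _]mulrC [a * denom_val s]mulrC.
Qed.
Fact mloc_scaleDl x : {morph mloc_scale^~ x : a b / a + b}.
Proof.
by move=> a b; case: (mlocP x) => n s; rewrite !mloc_scaleE scalerDl fracD.
Qed.

HB.instance Definition _ := GRing.Zmodule_isLmodule.Build A mloc
  mloc_scaleA mloc_scale1 mloc_scaleDr mloc_scaleDl.

Lemma frac_scale a n s : a *: frac n s = frac (a *: n) s.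
Proof. exact: mloc_scaleE. Qed.

Fact frac_linear s : linear (frac^~ s).
Proof. by move=> a n m; rewrite fracD frac_scale. Qed.
End Localization.

Section LocalizationMap.
Variables (A : comPzRingType) (S : mulrClosed A) (N N' : lmodType A).
Variable f : {linear N -> N'}.

Definition mloc_map (x : mloc S N) : mloc S N' :=
  frac (f (mloc_repr x).1) (mloc_repr x).2.

Lemma mloc_mapE n s : mloc_map (frac n s) = frac (f n) s.
Proof.
have [u e] := mloc_reprP n s; apply/frac_eq; exists u.
by rewrite -!linearZ /= e.
Qed.

Fact mloc_map_linear : linear mloc_map.
Proof.
move=> a x y; case: (mlocP x) => n s; case: (mlocP y) => m t.
rewrite frac_scale frac_add !mloc_mapE frac_scale frac_add.
by rewrite linearD !(linearZ_LR f).
Qed.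
HB.instance Definition _ :=
  GRing.isLinear.Build A (mloc S N) (mloc S N') *:%R mloc_map mloc_map_linear.
End LocalizationMap.

Definition powers (A : comPzRingType) (a : A) : {pred A} :=
  fun b => `[< exists k, b = a ^+ k >].

Section Powers.
Variables (A : comPzRingType) (a : A).
Fact powers_closed : mulr_closed (powers a).
Proof.
split=> [|_ _ /asboolP[k ->] /asboolP[l ->]]; apply/asboolP.
  by exists 0%N.
by exists (k + l)%N; rewrite exprD.
Qed.
HB.instance Definition _ := GRing.isMulClosed.Build A (powers a) powers_closed.
End Powers.

(** [ring_quotient.prime_idealr] requires a nontrivial ring. *)
Record prime_ideal (A : comPzRingType) := PrimeIdeal {
  prime_pred :> {pred A};
  prime0 : 0 \in prime_pred;
  primeD : {in prime_pred &, forall a b, a + b \in prime_pred};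
  primeM : forall a, {in prime_pred, forall b, a * b \in prime_pred};
  prime1 : 1 \notin prime_pred;
  primeP : forall a b,
    a * b \in prime_pred -> (a \in prime_pred) || (b \in prime_pred) }.

Definition prime_compl (A : comPzRingType) (p : prime_ideal A) : {pred A} :=
  fun a => a \notin prime_pred p.

Section PrimeCompl.
Variables (A : comPzRingType) (p : prime_ideal A).
Fact prime_compl_closed : mulr_closed (prime_compl p).
Proof.
split=> [|a b ap bp]; first exact: prime1.
by apply/negP => /primeP; apply/negP; rewrite negb_or; apply/andP.
Qed.
HB.instance Definition _ :=
  GRing.isMulClosed.Build A (prime_compl p) prime_compl_closed.
End PrimeCompl.

Definition nonzero_module (A : comPzRingType) (N : lmodType A) : Prop :=
  exists n : N, n <> 0.

Definition localization_at (A : comPzRingType) (p : prime_ideal A)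
  (N : lmodType A) : lmodType A := mloc (prime_compl p) N.

Definition in_support (A : comPzRingType) (N : lmodType A) (p : prime_ideal A)
  : Prop := nonzero_module (localization_at p N).

(** The submodule [xN] generated by the products [x_i n]. *)
Definition seq_mul (A : comPzRingType) (x : seq A) (N : lmodType A) : {pred N} :=
  fun n => `[< exists u : 'I_(size x) -> N, n = \sum_(i < size x) x`_i *: u i >].
Arguments seq_mul {A} x N.

Section SeqMul.
Variables (A : comPzRingType) (x : seq A) (N : lmodType A).
Fact seq_mul_closed : subsemimod_closed (seq_mul x N).
Proof.
split; first split.
- apply/asboolP; exists (fun=> 0).
  by rewrite big1 // => i _; rewrite scaler0.
- move=> _ _ /asboolP[u ->] /asboolP[v ->]; apply/asboolP.
  exists (fun i => u i + v i).
  by rewrite -big_split; apply: eq_bigr => i _; rewrite scalerDr.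
- move=> a _ /asboolP[u ->]; apply/asboolP; exists (fun i => a *: u i).
  by rewrite scaler_sumr; apply: eq_bigr => i _; rewrite !scalerA mulrC.
Qed.
HB.instance Definition _ :=
  GRing.isSubmodClosed.Build A N (seq_mul x N) seq_mul_closed.
End SeqMul.

Definition quot_seq (A : comPzRingType) (N : lmodType A) (x : seq A)
  : lmodType A := quot_mod (seq_mul x N).

Definition nonzerodivisor_on (A : comPzRingType) (N : lmodType A) (a : A) : Prop :=
  forall n : N, a *: n = 0 -> n = 0.

(** [x`_i] is the [i.+1]-st element and [take i x] are those preceding it. *)
Definition weak_regular_seq (A : comPzRingType) (N : lmodType A) (x : seq A)
  : Prop :=
  forall i, (i < size x)%N -> nonzerodivisor_on (quot_seq N (take i x)) x`_i.

Definition seq_mul_proper (A : comPzRingType) (N : lmodType A) (x : seq A) : Prop :=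
  exists n : N, n \notin seq_mul x N.

Definition regular_seq (A : comPzRingType) (N : lmodType A) (x : seq A) : Prop :=
  x = [::] \/ weak_regular_seq N x /\ seq_mul_proper N x.

Record chain_complex (A : comPzRingType) := ChainComplex {
  ch_obj :> nat -> lmodType A;
  ch_d : forall i, {linear ch_obj i.+1 -> ch_obj i};
  ch_dd : forall i c, ch_d i (ch_d i.+1 c) = 0 }.

Section Homology.
Variables (A : comPzRingType) (C : chain_complex A) (i : nat).

Definition cycles : {pred C i} :=
  match i return {pred C i} with
  | 0 => fun=> true
  | j.+1 => fun c => ch_d C j c == 0
  end.

Fact cycles_closed : subsemimod_closed cycles.
Proof.
rewrite /cycles; case: i => [|j] //.
split; first split; first by rewrite unfold_in linear0.
  by move=> u v /eqP du /eqP dv; rewrite unfold_in linearD du dv addr0.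
by move=> a u /eqP du; rewrite unfold_in linearZ_LR du scaler0.
Qed.
HB.instance Definition _ :=
  GRing.isSubmodClosed.Build A (C i) cycles cycles_closed.

Definition boundaries : {pred C i} :=
  fun c => `[< exists b : C i.+1, ch_d C i b = c >].

Fact boundaries_closed : subsemimod_closed boundaries.
Proof.
split; first split; first by apply/asboolP; exists 0; rewrite linear0.
  move=> _ _ /asboolP[u <-] /asboolP[v <-]; apply/asboolP.
  by exists (u + v); rewrite linearD.
by move=> a _ /asboolP[u <-]; apply/asboolP; exists (a *: u); rewrite linearZ_LR.
Qed.
HB.instance Definition _ :=
  GRing.isSubmodClosed.Build A (C i) boundaries boundaries_closed.

Definition homology : lmodType A := subquot cycles boundaries.

Definition homology_class (z : submod cycles) : homology := quot_pi _ z.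
End Homology.
Arguments cycles {A} C i.
Arguments boundaries {A} C i.
Arguments homology {A} C i.

Record chain_map (A : comPzRingType) (C D : chain_complex A) := ChainMap {
  ch_map :> forall i, {linear C i -> D i};
  ch_mapC : forall i c, ch_d D i (ch_map i.+1 c) = ch_map i (ch_d C i c) }.

Section HomologyMap.
Variables (A : comPzRingType) (C D : chain_complex A) (f : chain_map C D).
Variable i : nat.

Fact cycles_map (z : submod (cycles C i)) : f i (submod_val z) \in cycles D i.
Proof.
case: z => z /=; case: i z => [|j] z; rewrite !unfold_in //= => /eqP dz.
by rewrite ch_mapC dz linear0.
Qed.

Definition cycle_map (z : submod (cycles C i)) : submod (cycles D i) :=
  Submod (cycles_map z).

Definition homology_map (h : homology C i) : homology D i :=
  homology_class (cycle_map (repr (h : Quotient.quot _))).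

Lemma homology_mapE z :
  homology_map (homology_class z) = homology_class (cycle_map z).
Proof.
rewrite /homology_map /homology_class; set r := repr _.
have /quot_pi_eq/asboolP[b db] := quot_repr (homology_class z).
apply/quot_pi_eq/asboolP; exists (f i.+1 b); rewrite ch_mapC db.
by rewrite -!/(val _) !raddfB.
Qed.
End HomologyMap.

(** [koszul_tensor a C] is [K(a) ⊗ C], with [K(a) = (A --a--> A)] in degrees
    1 and 0, after identifying [A ⊗ C] with [C]: its degree [i.+1] part is
    [C i.+1 ⊕ C i], the second summand being that of degree 1 in [K(a)]. *)
Section KoszulTensor.
Variables (A : comPzRingType) (a : A) (C : chain_complex A).

Definition kt_obj (i : nat) : lmodType A :=
  match i with 0 => C 0 | j.+1 => (C j.+1 * C j)%type end.

Definition kt_d0 (c : C 1 * C 0) : C 0 := ch_d C 0 c.1 + a *: c.2.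
Definition kt_dS i (c : C i.+2 * C i.+1) : C i.+1 * C i :=
  (ch_d C i.+1 c.1 + a *: c.2, - ch_d C i c.2).

Fact kt_d0_linear : linear kt_d0.
Proof.
move=> b u v; rewrite /kt_d0 /= linearP scalerDr scalerDr addrACA.
by rewrite !scalerA mulrC.
Qed.
Fact kt_dS_linear i : linear (@kt_dS i).
Proof.
move=> b u v; congr pair => /=; last by rewrite linearP opprD scalerN.
by rewrite linearP scalerDr scalerDr addrACA !scalerA mulrC.
Qed.

Definition kt_d i : {linear kt_obj i.+1 -> kt_obj i} :=
  match i with
  | 0 => linear_of kt_d0_linear
  | j.+1 => linear_of (@kt_dS_linear j)
  end.

Fact kt_dd i c : kt_d i (kt_d i.+1 c) = 0.
Proof.
case: i c => [|i] [u v] /=.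
  by rewrite /kt_d0 /= linearD ch_dd add0r linearZ_LR scalerN subrr.
rewrite /kt_dS /= linearD ch_dd add0r linearZ_LR scalerN subrr.
by rewrite linearN ch_dd !oppr0.
Qed.

Definition koszul_tensor : chain_complex A := ChainComplex kt_dd.
End KoszulTensor.

Definition concentrated_obj (A : comPzRingType) (N : lmodType A) (i : nat)
  : lmodType A := if i is 0 then N else 'rV[A]_0.

Section Concentrated.
Variables (A : comPzRingType) (N : lmodType A).

Fact null_linear (U V : lmodType A) : linear (fun _ : U => 0 : V).
Proof. by move=> a u v; rewrite scaler0 addr0. Qed.

Definition concentrated_chain : chain_complex A :=
  @ChainComplex A (concentrated_obj N) (fun=> linear_of (@null_linear _ _))
    (fun _ _ => erefl).
End Concentrated.

(** [K(x_1) ⊗ (K(x_2) ⊗ ... ⊗ (K(x_l) ⊗ N))] *)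
Definition koszul (A : comPzRingType) (N : lmodType A) (x : seq A)
  : chain_complex A :=
  foldr (@koszul_tensor A) (concentrated_chain N) x.

Section KoszulTensorMap.
Variables (A : comPzRingType) (a b c : A).
Hypothesis abc : a = b * c.
Variables (C D : chain_complex A) (f : chain_map C D).

Definition ktm_S i (u : C i.+1 * C i) : D i.+1 * D i :=
  (f i.+1 u.1, b *: f i u.2).

Fact ktm_S_linear i : linear (@ktm_S i).
Proof.
move=> d u v; congr pair; rewrite /= linearP //.
by rewrite scalerDr !scalerA mulrC.
Qed.

Definition ktm i : {linear koszul_tensor a C i -> koszul_tensor c D i} :=
  match i with
  | 0 => f 0
  | j.+1 => linear_of (@ktm_S_linear j)
  end.

Fact ktmC i u :
  ch_d (koszul_tensor c D) i (ktm i.+1 u) = ktm i (ch_d (koszul_tensor a C) i u).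
Proof.
case: i u => [|i] [u v] /=.
  rewrite /kt_d0 /= ch_mapC linearD (linearZ_LR (f 0)) scalerA.
  by rewrite abc mulrC.
congr pair => /=; last by rewrite linearZ_LR ch_mapC linearN scalerN.
by rewrite ch_mapC linearD (linearZ_LR (f i.+1)) scalerA abc mulrC.
Qed.

Definition koszul_tensor_map
  : chain_map (koszul_tensor a C) (koszul_tensor c D) := ChainMap ktmC.
End KoszulTensorMap.

Definition chain_id (A : comPzRingType) (C : chain_complex A) : chain_map C C :=
  @ChainMap A C C (fun=> idfun) (fun _ _ => erefl).

Definition seq_pow (A : comPzRingType) (x : seq A) (m : nat) : seq A :=
  [seq a ^+ m | a <- x].

Fact pow_sub (A : comPzRingType) (a : A) m n :
  (n <= m)%N -> a ^+ m = a ^+ (m - n) * a ^+ n.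
Proof. by move=> le_nm; rewrite -exprD subnK. Qed.

(** Multiplication by [x_j ^+ (m - n)] in degree 1 of [K(x_j ^+ m)], and the
    identity in degree 0. *)
Fixpoint koszul_map (A : comPzRingType) (N : lmodType A) m n (le_nm : (n <= m)%N)
    (x : seq A) : chain_map (koszul N (seq_pow x m)) (koszul N (seq_pow x n)) :=
  match x with
  | [::] => chain_id (concentrated_chain N)
  | a :: y => koszul_tensor_map (pow_sub a le_nm) (koszul_map N le_nm y)
  end.

Definition weakly_proregular (A : comPzRingType) (N : lmodType A) (x : seq A)
  : Prop :=
  forall n, exists m, exists le_nm : (n <= m)%N, forall i, (1 <= i)%N ->
  forall h : homology (koszul N (seq_pow x m)) i,
    homology_map (koszul_map N le_nm x) h = 0.

Record cochain_complex (A : comPzRingType) := CochainComplex {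
  coch_obj :> nat -> lmodType A;
  coch_d : forall i, {linear coch_obj i -> coch_obj i.+1};
  coch_dd : forall i c, coch_d i.+1 (coch_d i c) = 0 }.

Section Cohomology.
Variables (A : comPzRingType) (C : cochain_complex A) (i : nat).

Definition cocycles : {pred C i} := fun c => coch_d C i c == 0.

Fact cocycles_closed : subsemimod_closed cocycles.
Proof.
split; first split; first by rewrite unfold_in /cocycles linear0.
  by move=> u v /eqP du /eqP dv; rewrite unfold_in /cocycles linearD du dv addr0.
by move=> a u /eqP du; rewrite unfold_in /cocycles linearZ_LR du scaler0.
Qed.
HB.instance Definition _ :=
  GRing.isSubmodClosed.Build A (C i) cocycles cocycles_closed.

Definition coboundaries : {pred C i} :=
  match i return {pred C i} with
  | 0 => fun c => c == 0
  | j.+1 => fun c => `[< exists b : C j, coch_d C j b = c >]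
  end.

Fact coboundaries_closed : subsemimod_closed coboundaries.
Proof.
rewrite /coboundaries; case: i => [|j].
  split; first split; first by rewrite unfold_in.
    by move=> u v /eqP -> /eqP ->; rewrite unfold_in addr0.
  by move=> a u /eqP ->; rewrite unfold_in scaler0.
split; first split; first by apply/asboolP; exists 0; rewrite linear0.
  move=> _ _ /asboolP[u <-] /asboolP[v <-]; apply/asboolP.
  by exists (u + v); rewrite linearD.
by move=> a _ /asboolP[u <-]; apply/asboolP; exists (a *: u); rewrite linearZ_LR.
Qed.
HB.instance Definition _ :=
  GRing.isSubmodClosed.Build A (C i) coboundaries coboundaries_closed.

Definition cohomology : lmodType A := subquot cocycles coboundaries.
End Cohomology.
Arguments cohomology {A} C i.

(** [cech_tensor a C] is [C(a) ⊗ C], with [C(a) = (A -> A_a)] in degrees 0 and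
    1, after identifying [A ⊗ C] with [C] and [A_a ⊗ C] with [C_a]. *)
Section CechTensor.
Variables (A : comPzRingType) (a : A) (C : cochain_complex A).
Local Notation loc := (mloc (powers a)).

Definition ct_obj (i : nat) : lmodType A :=
  match i with 0 => C 0 | j.+1 => (C j.+1 * loc (C j))%type end.

Definition ct_d0 (c : C 0) : C 1 * loc (C 0) :=
  (coch_d C 0 c, frac c (denom1 _)).
Definition ct_dS i (c : C i.+1 * loc (C i)) : C i.+2 * loc (C i.+1) :=
  (coch_d C i.+1 c.1, frac c.1 (denom1 _) - mloc_map (coch_d C i) c.2).

Fact ct_d0_linear : linear ct_d0.
Proof. by move=> b u v; congr pair; rewrite /= ?linearP // frac_linear. Qed.
Fact ct_dS_linear i : linear (@ct_dS i).
Proof.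
move=> b u v; congr pair; rewrite /= ?linearP // frac_linear.
by rewrite scalerDr addrACA.
Qed.

Definition ct_d i : {linear ct_obj i -> ct_obj i.+1} :=
  match i with
  | 0 => linear_of ct_d0_linear
  | j.+1 => linear_of (@ct_dS_linear j)
  end.

Fact frac0 (N : lmodType A) s : frac 0 s = 0 :> loc N.
Proof. by rewrite -[X in frac X _](scale0r 0) -frac_scale scale0r. Qed.

Fact ct_dd i c : ct_d i.+1 (ct_d i c) = 0.
Proof.
case: i c => [u|i [u v]] /=.
  by rewrite /ct_dS /= mloc_mapE subrr coch_dd.
rewrite /ct_dS /= coch_dd; congr pair.
rewrite (raddfB (mloc_map _)); case: (mlocP v) => n s; rewrite mloc_mapE /=.
by rewrite [X in _ - (X - _)]mloc_mapE [X in _ - (_ - X)]mloc_mapE coch_dd frac0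
  subr0 subrr.
Qed.

Definition cech_tensor : cochain_complex A := CochainComplex ct_dd.
End CechTensor.

Definition concentrated_cochain (A : comPzRingType) (N : lmodType A)
  : cochain_complex A :=
  @CochainComplex A (concentrated_obj N) (fun=> linear_of (@null_linear _ _ _))
    (fun _ _ => erefl).

(** [C(x_1) ⊗ (C(x_2) ⊗ ... ⊗ (C(x_l) ⊗ N))] *)
Definition cech (A : comPzRingType) (N : lmodType A) (x : seq A)
  : cochain_complex A :=
  foldr (@cech_tensor A) (concentrated_cochain N) x.

Definition cech_cohomology (A : comPzRingType) (N : lmodType A) (x : seq A)
  (i : nat) : lmodType A := cohomology (cech N x) i.

(** The empty sequence is a parameter sequence, and a regular sequence, on every
    module by convention, including the zero module. *)
Definition parameter_seq (A : comPzRingType) (N : lmodType A) (x : seq A) : Prop :=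
  x = [::] \/
  [/\ weakly_proregular N x,
      seq_mul_proper N x &
      forall p : prime_ideal A, in_support (quot_seq N x) p ->
        nonzero_module (localization_at p (cech_cohomology N x (size x)))].

Definition strong_parameter_seq (A : comPzRingType) (N : lmodType A) (x : seq A)
  : Prop :=
  forall i, (1 <= i <= size x)%N -> parameter_seq N (take i x).

Definition cohen_macaulay (A : comPzRingType) (N : lmodType A) : Prop :=
  forall x : seq A, strong_parameter_seq N x -> regular_seq N x.

Definition cohen_macaulay_ring (A : comPzRingType) : Prop :=
  cohen_macaulay (A^o : lmodType A).

(* Main.v *)
Require Import Defs.
From HB Require Import structures.
From mathcomp Require Import all_boot all_algebra.
From mathcomp Require Import ring zify.
From mathcomp Require Import boolp.

Set Implicit Arguments.
Unset Strict Implicit.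
Unset Printing Implicit Defensive.

(* [frac] must mean the fractions of a localized module, not those of the field
   of fractions of a domain. *)
Import Defs GRing.Theory.
Local Open Scope ring_scope.

(** Write [S] for [R ⋉ M], [π : S -> R] for the projection and [ι : R -> S] for
    its section.  As an [S]-module, [S] is an extension of [R] by [M], on which
    [S] acts through [π]; along [ι] this extension splits.  Moreover [S] and [R]
    differ by the square-zero ideal [M], so they have the same primes.

    The heart of the matter is that a sequence [z] of [S] is a parameter sequence
    on [S] exactly when [π z] is one on [R] ([te_parameter_seq]).

    - Weak proregularity.  If [π z] is weakly proregular on [R], the hypothesis
      makes it so on [M], and the Koszul complex of [z] on [S] is an extension of
      the complexes of [π z] on [R] and on [M]: [weakly_proregular_extension].
      Conversely [z] and [ι (π z)] differ by square-zero elements, and for such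
      sequences the Koszul complexes of the powers form equivalent inverse
      systems ([weakly_proregular_sqr0]); then [R], being a direct summand of [S]
      along [ι], inherits weak proregularity ([weakly_proregular_summand]).
    - Top Čech cohomology.  Every element of it is the class of a fraction
      [n / (x_1 ... x_l) ^ k], which vanishes exactly when
      [(x_1 ... x_l) ^ t n] lies in [(x_1 ^ (t + k), ..., x_l ^ (t + k)) N] for
      some [t] ([cech_top_coboundary]).  On a ring it is enough to look at
      [n = 1], and there the condition is transported by [π], and back by [ι] at
      the price of shifting exponents.

    The other ingredient is that regular sequences are strong parameter sequences
    ([regular_strong_parameter_seq]).  This rests on Koszul acyclicity, which,
    unlike weak regularity, is visibly stable under permutation and under taking
    powers.  It makes weak proregularity immediate, and it provides the colon
    formula [(x_1 ^ (t + k), ...) : (x_1 ... x_l) ^ t = (x_1 ^ k, ...)], by which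
    the class of [1 / (x_1 ... x_l)] survives at every prime containing the
    sequence.

    The theorem follows.  If [S] is Cohen-Macaulay and [x] is a strong parameter
    sequence on [R], for instance a regular one, then [ι x] is [S]-regular, hence
    [x] is weakly regular on the summands [R] and [M].  Conversely, a strong
    parameter sequence [z] on [S] has a regular image [π z], which is then weakly
    regular on [M]; and weak regularity on [M] and on [R] passes to the extension
    [S] ([weak_regular_extension]). *)

(** * The submodules [xN] and weak regularity *)

Lemma quot_pi_eq0 (A : comPzRingType) (N : lmodType A) (B : submodClosed N) n :
  quot_pi B n = 0 <-> n \in B.
Proof. by rewrite -[X in _ = X](raddf0 (quot_pi B)) quot_pi_eq subr0. Qed.

Section SeqMul.
Variables (A : comPzRingType) (N : lmodType A).
Implicit Types (a b : A) (x y : seq A) (n : N).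

Lemma seq_mul_ind x (P : N -> Prop) :
    P 0 -> (forall u v, P u -> P v -> P (u + v)) ->
    (forall a n, a \in x -> P (a *: n)) ->
  forall n, n \in seq_mul x N -> P n.
Proof.
move=> P0 PD PZ n /asboolP[u ->]; apply: big_ind => // i _.
by apply/PZ/mem_nth.
Qed.

Lemma seq_mul_gen x a n : a \in x -> a *: n \in seq_mul x N.
Proof.
move=> ax; apply/asboolP.
have ix : (index a x < size x)%N by rewrite index_mem.
exists (fun i => if i == Ordinal ix then n else 0).
rewrite (bigD1 (Ordinal ix)) //= eqxx nth_index // big1 ?addr0 // => i /negPf->.
by rewrite scaler0.
Qed.

Lemma seq_mul_mono x y : {subset x <= y} ->
  {subset seq_mul x N <= seq_mul y N}.
Proof.
move=> xy; apply: (@seq_mul_ind x (fun n => n \in seq_mul y N)).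
    exact: rpred0.
  by move=> u v; apply: rpredD.
by move=> a n /xy; apply: seq_mul_gen.
Qed.

Lemma seq_mul_nil n : n \in seq_mul [::] N -> n = 0.
Proof. by apply: (@seq_mul_ind [::] (fun n => n = 0)) => // u v -> ->; rewrite addr0. Qed.

Lemma seq_mul_cons a x n :
  (n \in seq_mul (a :: x) N) <-> exists n', n - a *: n' \in seq_mul x N.
Proof.
split=> [|[n' h]]; last first.
  rewrite -(subrK (a *: n') n) rpredD ?seq_mul_gen ?mem_head //.
  by apply: (seq_mul_mono (y := a :: x)) h => b; rewrite in_cons orbC => ->.
move: n; apply: (@seq_mul_ind (a :: x)) => [|u v [u' hu] [v' hv]|b n].
- by exists 0; rewrite scaler0 subrr rpred0.
- by exists (u' + v'); rewrite scalerDr opprD addrACA rpredD.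
- rewrite in_cons => /orP[/eqP->|bx]; first by exists n; rewrite subrr rpred0.
  by exists 0; rewrite scaler0 subr0 seq_mul_gen.
Qed.

Lemma seq_mul_rcons x a n :
  (n \in seq_mul (rcons x a) N) <-> exists n', n - a *: n' \in seq_mul x N.
Proof.
rewrite -seq_mul_cons; split; apply: seq_mul_mono => b;
  by rewrite mem_rcons.
Qed.

Lemma weak_regular_seqP x :
  weak_regular_seq N x <-> forall i n, (i < size x)%N ->
    x`_i *: n \in seq_mul (take i x) N -> n \in seq_mul (take i x) N.
Proof.
split=> [wx i n ix /quot_pi_eq0|wx i ix n]; first by rewrite linearZ => /(wx _ ix)/quot_pi_eq0.
rewrite -[n]quot_repr; move: (repr _) => m.
by rewrite -linearZ => /quot_pi_eq0/(wx _ _ ix)/quot_pi_eq0.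
Qed.

Lemma weak_regular_take x i : weak_regular_seq N x -> weak_regular_seq N (take i x).
Proof.
move=> /weak_regular_seqP wx; apply/weak_regular_seqP => j n.
rewrite size_take_min leq_min => /andP[ji jx].
by rewrite nth_take // take_takel ?(ltnW ji) //; apply: wx.
Qed.

Lemma weak_regular_rcons x a : weak_regular_seq N (rcons x a) <->
  weak_regular_seq N x /\
  (forall n, a *: n \in seq_mul x N -> n \in seq_mul x N).
Proof.
rewrite !weak_regular_seqP; split=> [wx|[wx wa] i n].
  split=> [i n ix|n an].
    have := wx i n; rewrite size_rcons nth_rcons ix -cats1 takel_cat ?(ltnW ix) //.
    by apply; apply: ltnW.
  have := wx (size x) n; rewrite size_rcons nth_rcons ltnn eqxx -cats1.
  by rewrite take_size_cat //; apply.
rewrite size_rcons ltnS leq_eqVlt => /orP[/eqP->|ix].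
  by rewrite nth_rcons ltnn eqxx -cats1 take_size_cat //; apply: wa.
by rewrite nth_rcons ix -cats1 takel_cat ?(ltnW ix) //; apply: wx.
Qed.

End SeqMul.

Lemma seq_mul_map (A A' : comPzRingType) (N : lmodType A) (N' : lmodType A')
    (x : seq A) (x' : seq A') (f : {additive N -> N'}) :
    (forall a n, a \in x -> f (a *: n) \in seq_mul x' N') ->
  forall n, n \in seq_mul x N -> f n \in seq_mul x' N'.
Proof.
move=> fx; apply: (@seq_mul_ind _ _ _ (fun n => f n \in seq_mul x' N')) => [|u v|//].
  by rewrite raddf0 rpred0.
by rewrite raddfD; apply: rpredD.
Qed.

(** * Acyclic Koszul complexes *)

Section WeaklyProregular.
Variables (A : comPzRingType) (N : lmodType A).

Lemma weakly_proregularP (x : seq A) : weakly_proregular N x <->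
  forall n, exists m, exists le_nm : (n <= m)%N,
    forall i (c : koszul N (seq_pow x m) i.+1),
      ch_d (koszul N (seq_pow x m)) i c = 0 ->
      exists e, ch_d (koszul N (seq_pow x n)) i.+1 e = koszul_map N le_nm x i.+1 c.
Proof.
split=> wx n; have [m [le_nm wm]] := wx n; exists m, le_nm.
  move=> i c dc.
  have cZ : c \in cycles (koszul N (seq_pow x m)) i.+1 by apply/eqP.
  have := wm i.+1 isT (homology_class (Submod cZ)).
  by rewrite homology_mapE => /quot_pi_eq0/asboolP.
case=> // i _ h; rewrite -[h]quot_repr; set z := repr _.
rewrite [LHS]homology_mapE; apply/quot_pi_eq0/asboolP.
by apply: wm; apply/eqP; case: z.
Qed.

End WeaklyProregular.

Section Acyclic.
Variable A : comPzRingType.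
Implicit Types (a b : A) (C D : chain_complex A).

(** Degree 0 is left out: for a Koszul complex its homology is [N / xN]. *)
Definition acyclic C : Prop :=
  forall i (c : C i.+1), ch_d C i c = 0 -> exists e, ch_d C i.+1 e = c.

Definition chain_iso C D : Prop :=
  exists f : chain_map C D, forall i, bijective (f i).

Lemma acyclic_iso C D : chain_iso C D -> acyclic D -> acyclic C.
Proof.
case=> f bf aD i c dc.
have [|e he] := aD i (f i.+1 c); first by rewrite ch_mapC dc raddf0.
have [g _ fg] := bf i.+2; exists (g e).
by apply: (bij_inj (bf i.+1)); rewrite -ch_mapC fg.
Qed.

Lemma koszul_tensor_iso a C D :
  chain_iso C D -> chain_iso (koszul_tensor a C) (koszul_tensor a D).
Proof.
case=> f bf; exists (koszul_tensor_map (esym (mul1r a)) f) => -[|i] //=.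
  exact: (bf 0%N).
have [g gf fg] := bf i.+1; have [h hf fh] := bf i.
exists (fun u => (g u.1, h u.2)) => -[u v]; congr pair => //=;
  by rewrite scale1r.
Qed.

(** The symmetry of the tensor product; as usual it exchanges two classes of
    degree 1 up to a sign. *)
Definition koszul_swap_fun a b C i :
    koszul_tensor a (koszul_tensor b C) i ->
    koszul_tensor b (koszul_tensor a C) i :=
  match i with
  | 0 => id
  | 1 => fun u => ((u.1.1, u.2), u.1.2)
  | j.+2 => fun u => ((u.1.1, u.2.1), (u.1.2, - u.2.2))
  end.

Fact koszul_swap_linear a b C i : linear (@koszul_swap_fun a b C i).
Proof.
case: i => [|[|i]] r u v //=; do 2!congr pair => //=.
by rewrite opprD scalerN.
Qed.

Fact koszul_swapC a b C i u :
  ch_d (koszul_tensor b (koszul_tensor a C)) i (koszul_swap_fun u)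
  = koszul_swap_fun (ch_d (koszul_tensor a (koszul_tensor b C)) i u).
Proof.
case: i u => [[[u v] w]|[[[u v] [w t]]|i [[u v] [w t]]]] /=.
- by rewrite /kt_d0 /= /kt_d0 /= addrAC.
- rewrite /kt_dS /= /kt_d0 /kt_dS /=.
  apply: injective_projections; last by rewrite /= opprD scalerN opprK.
  by apply: injective_projections; rewrite /= ?scalerN ?opprD // addrAC.
- rewrite /kt_dS /=; apply: injective_projections;
    apply: injective_projections; rewrite /= ?scalerN ?opprD ?opprK ?linearN //.
  by rewrite addrAC.
Qed.

Definition koszul_swap a b C :
    chain_map (koszul_tensor a (koszul_tensor b C))
              (koszul_tensor b (koszul_tensor a C)) :=
  @ChainMap A _ _ (fun i => linear_of (@koszul_swap_linear a b C i))
    (@koszul_swapC a b C).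

Lemma koszul_swap_iso a b C :
  chain_iso (koszul_tensor a (koszul_tensor b C))
            (koszul_tensor b (koszul_tensor a C)).
Proof.
exists (koszul_swap a b C) => i; exists (@koszul_swap_fun b a C i);
  case: i => [|[|i]] //.
- by case=> [[u v] w].
- by move=> [[u v] [w t]]; rewrite /= opprK.
- by case=> [[u v] w].
- by move=> [[u v] [w t]]; rewrite /= opprK.
Qed.

Lemma chain_iso_refl C : chain_iso C C.
Proof. by exists (chain_id C) => i; exists id. Qed.

Definition chain_comp C D E (g : chain_map D E) (f : chain_map C D) :
  chain_map C E.
Proof.
refine (@ChainMap A C E (fun i => g i \o f i) _) => i c /=.
by rewrite !ch_mapC.
Defined.

Lemma chain_iso_trans C D E : chain_iso C D -> chain_iso D E -> chain_iso C E.
Proof.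
case=> f bf [g bg]; exists (chain_comp g f) => i.
exact: bij_comp (bg i) (bf i).
Qed.

Variable N : lmodType A.
Implicit Types x y : seq A.

Lemma koszul_cat_cons_iso x a y :
  chain_iso (koszul N (a :: x ++ y)) (koszul N (x ++ a :: y)).
Proof.
elim: x => [|b x IH]; first exact: chain_iso_refl.
apply: chain_iso_trans (koszul_swap_iso _ _ _) _.
exact: koszul_tensor_iso.
Qed.

Lemma koszul_perm_iso x y : perm_eq x y -> chain_iso (koszul N x) (koszul N y).
Proof.
elim: x y => [|a x IH] y.
  by rewrite perm_sym => /perm_nilP->; apply: chain_iso_refl.
move=> pxy; have ay : a \in y by rewrite -(perm_mem pxy) mem_head.
case/splitPr: ay pxy => y1 y2; rewrite perm_sym (perm_catCA y1 [:: a]).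
rewrite perm_cons perm_sym => /IH x_iso.
exact: chain_iso_trans (koszul_tensor_iso a x_iso) (koszul_cat_cons_iso _ _ _).
Qed.

(** The degree 0 part of the Koszul complex is [N], but only after reduction along
    the sequence. *)
Fixpoint koszul_in0 x : N -> koszul N x 0 :=
  if x is a :: y then koszul_in0 y else id.

Lemma koszul_in0_linear x : linear (koszul_in0 x).
Proof. by elim: x. Qed.

Lemma koszul_in0Z x a n : koszul_in0 x (a *: n) = a *: koszul_in0 x n.
Proof. by elim: x. Qed.

Lemma koszul_in0_surj x c : exists n, koszul_in0 x n = c.
Proof. by elim: x c => [|a x IH] c //; exists c. Qed.

Lemma koszul_in0_boundary x n :
  (exists e, ch_d (koszul N x) 0 e = koszul_in0 x n) <-> n \in seq_mul x N.
Proof.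
elim: x n => [|a x IH] n.
  split=> [[e] /= <-|/seq_mul_nil->]; first exact: rpred0.
  by exists 0; rewrite linear0.
split=> [[[e c] de]|/seq_mul_cons[n' /IH[e de]]].
  apply/seq_mul_cons; have [n' hn'] := koszul_in0_surj c; exists n'.
  apply/IH; exists e; rewrite addrC -scaleNr koszul_in0_linear hn'.
  by rewrite -[koszul_in0 x n]de scaleNr addrC addrK.
exists (e, koszul_in0 x n'); rewrite /= /kt_d0 /= de.
by rewrite addrC -koszul_in0_linear addrC subrK.
Qed.

Definition koszul_acyclic x : Prop := acyclic (koszul N x).

Lemma koszul_acyclic_perm x y :
  perm_eq x y -> koszul_acyclic x -> koszul_acyclic y.
Proof. by rewrite perm_sym => /koszul_perm_iso; apply: acyclic_iso. Qed.

(** The complexes on [a], [b] and [a * b] fit in a triangle: a cycle for [a * b]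
    gives one for [a], whose bounding chain leaves a cycle for [b]. *)
Lemma koszul_acyclicM a b x : koszul_acyclic (a :: x) ->
  koszul_acyclic (b :: x) -> koszul_acyclic (a * b :: x).
Proof.
move=> ax bx.
have glue i (u : koszul N x i.+1) (v : koszul N x i) :
    ch_d (koszul N (a :: x)) i (u, b *: v) = 0 ->
    (forall w, ch_d (koszul N x) i w + b *: v = 0 ->
       ch_d (koszul N (b :: x)) i (w, v) = 0) ->
    exists e, ch_d (koszul N (a * b :: x)) i.+1 e = (u, v).
  move=> /ax[[w w'] dw] bv.
  have {dw} [dw dw'] : ch_d (koszul N x) i.+1 w + a *: w' = u /\
      - ch_d (koszul N x) i w' = b *: v.
    by split; [apply: (congr1 fst dw) | apply: (congr1 snd dw)].
  have [|[s s'] ds] := bx i (w', v).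
    by apply: bv; rewrite -dw' subrr.
  have {ds} [ds ds'] : ch_d (koszul N x) i.+1 s + b *: s' = w' /\
      - ch_d (koszul N x) i s' = v.
    by split; [apply: (congr1 fst ds) | apply: (congr1 snd ds)].
  exists (w + a *: s, s'); apply: injective_projections => //=.
  by rewrite linearD linearZ_LR -addrA -scalerA -scalerDr ds.
case=> [|i] [u v] duv; apply: glue => //.
- by rewrite /= /kt_d0 /= scalerA.
- have du : ch_d (koszul N x) i.+1 u + (a * b) *: v = 0 := congr1 fst duv.
  have dv : - ch_d (koszul N x) i v = 0 := congr1 snd duv.
  apply: injective_projections; rewrite /= ?scalerA //.
  by rewrite linearZ_LR -scalerN dv scaler0.
- move=> w dw; apply: injective_projections => //=.
  exact: (congr1 snd duv).
Qed.

Lemma koszul_acyclic1 x : koszul_acyclic (1 :: x).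
Proof.
move=> i [u v] duv; exists (0, u); apply: injective_projections => /=.
  by rewrite linear0 add0r scale1r.
have : ch_d (koszul N x) i u + 1 *: v = 0.
  by case: i u v duv => [|i] u v duv //; apply: (congr1 fst duv).
by rewrite scale1r => /eqP; rewrite addrC addr_eq0 => /eqP.
Qed.

(** Thanks to permutation invariance each element can be brought to the front and
    replaced there by its power. *)
Lemma koszul_acyclic_pow m x y :
  koszul_acyclic (x ++ y) -> koszul_acyclic (seq_pow x m ++ y).
Proof.
elim: x y => [|a x IH] y // axy.
apply: (@koszul_acyclic_perm (seq_pow x m ++ a ^+ m :: y)).
  by rewrite (perm_catCA _ [:: _]).
apply: IH; apply: (@koszul_acyclic_perm (a ^+ m :: x ++ y)).
  by rewrite perm_sym (perm_catCA _ [:: _]).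
elim: m => [|m IHm]; first exact: koszul_acyclic1.
by rewrite exprS; apply: koszul_acyclicM.
Qed.

(** A relation [a n = x_1 n_1 + ... ] is a 1-cycle; it is a boundary, so its
    coefficient [n] lies in [xN].  With permutation invariance this applies to
    each element of the sequence modulo all the others. *)
Lemma koszul_acyclic_nzd a x n :
  koszul_acyclic (a :: x) -> a *: n \in seq_mul x N -> n \in seq_mul x N.
Proof.
move=> ax /koszul_in0_boundary[e de].
have [|[u v]] := ax 0%N ((- e, koszul_in0 x n) : koszul N (a :: x) 1).
  by rewrite /= /kt_d0 /= linearN de koszul_in0Z addNr.
move=> duv; apply/koszul_in0_boundary; exists (- v).
by rewrite linearN; apply: (congr1 snd duv).
Qed.

(** The last element of the sequence is a non-zero-divisor on [H_0] of the complex
    of the preceding ones, which is acyclic by induction. *)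
Lemma weak_regular_koszul_acyclic x : weak_regular_seq N x -> koszul_acyclic x.
Proof.
elim/last_ind: x => [|x a IH].
  move=> _ i c _; exists 0; rewrite linear0; apply/esym.
  by apply/rowP; case.
case/weak_regular_rcons => /IH xA na.
(* The Koszul complex is built with the first element outermost, whereas the
   induction adds the last one. *)
apply: (@koszul_acyclic_perm (a :: x)); first by rewrite perm_sym perm_rcons.
have lift i (u : koszul N x i.+1) (v : koszul N x i) :
    ch_d (koszul N x) i u + a *: v = 0 ->
    (exists e, ch_d (koszul N x) i e = v) ->
    exists e, ch_d (koszul N (a :: x)) i.+1 e = (u, v).
  move=> du [e de]; have [|w dw] := xA i (u + a *: e).
    by rewrite linearD linearZ_LR de.
  exists (w, - e); apply: injective_projections => /=.
    by rewrite dw scalerN addrK.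
  by rewrite linearN opprK.
case=> [|i] [u v] duv; apply: lift.
- exact: duv.
- have [n hn] := koszul_in0_surj v; rewrite -hn.
  apply/koszul_in0_boundary/na/koszul_in0_boundary; exists (- u).
  rewrite koszul_in0Z hn linearN; apply/eqP.
  by rewrite eqr_oppLR -addr_eq0; apply/eqP; apply: duv.
- exact: (congr1 fst duv).
- apply: xA; apply/eqP; rewrite -oppr_eq0; apply/eqP.
  exact: (congr1 snd duv).
Qed.

Lemma koszul_acyclic_weakly_proregular x :
  koszul_acyclic x -> weakly_proregular N x.
Proof.
move=> xA; apply/weakly_proregularP => n; exists n, (leqnn n) => i c dc.
have : koszul_acyclic (x ++ [::]) by rewrite cats0.
move/(koszul_acyclic_pow (m := n)); rewrite cats0 => xnA.
by apply: xnA; rewrite ch_mapC dc linear0.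
Qed.

(** The exponents are lowered one element at a time, those of [p] being already
    lowered: a factor [a ^ t] common to [a ^ t n] and [a ^ (t + k) n'] can be
    cancelled modulo the powers of the other elements. *)
Lemma koszul_acyclic_colon_cat p x t k n : koszul_acyclic (p ++ x) ->
  (\prod_(a <- x) a) ^+ t *: n \in seq_mul (seq_pow p k ++ seq_pow x (t + k)) N ->
  n \in seq_mul (seq_pow (p ++ x) k) N.
Proof.
elim: x p n => [|a x IH] p n pA.
  by rewrite big_nil expr1n scale1r !cats0.
rewrite big_cons exprMn -scalerA => nx.
have /seq_mul_cons[n'] : a ^+ t *: ((\prod_(b <- x) b) ^+ t *: n) \in
    seq_mul (a ^+ (t + k) :: seq_pow p k ++ seq_pow x (t + k)) N.
  apply: (seq_mul_mono _ nx) => b; rewrite /= !mem_cat !in_cons !mem_cat.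
  by rewrite orbCA.
rewrite exprD -scalerA -scalerBr => /koszul_acyclic_nzd nx'.
have {nx'} nx' : (\prod_(b <- x) b) ^+ t *: n - a ^+ k *: n' \in
    seq_mul (seq_pow p k ++ seq_pow x (t + k)) N.
  apply: nx'.
  have : koszul_acyclic ([:: a] ++ p ++ x).
    by apply: koszul_acyclic_perm pA; rewrite (perm_catCA _ [:: a]).
  move/(koszul_acyclic_pow (m := t)) => {}pA.
  have : koszul_acyclic (p ++ a ^+ t :: x).
    by apply: koszul_acyclic_perm pA; rewrite (perm_catCA [:: _]).
  move/(koszul_acyclic_pow (m := k)) => {}pA.
  have : koszul_acyclic (x ++ a ^+ t :: seq_pow p k).
    by apply: koszul_acyclic_perm pA; rewrite -cat_rcons perm_catC perm_cat2l perm_rcons.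
  move/(koszul_acyclic_pow (m := (t + k))).
  by apply: koszul_acyclic_perm; rewrite perm_catC.
rewrite -cat_rcons; apply: IH; first by rewrite cat_rcons.
have : (\prod_(b <- x) b) ^+ t *: n \in
    seq_mul (a ^+ k :: seq_pow p k ++ seq_pow x (t + k)) N.
  by apply/seq_mul_cons; exists n'.
apply/seq_mul_mono => b; rewrite /seq_pow map_rcons.
by rewrite !(mem_cat, mem_rcons, in_cons) orbA.
Qed.

Lemma koszul_acyclic_colon x t k n : koszul_acyclic x ->
  (\prod_(a <- x) a) ^+ t *: n \in seq_mul (seq_pow x (t + k)) N ->
  n \in seq_mul (seq_pow x k) N.
Proof. exact: (@koszul_acyclic_colon_cat [::]). Qed.

End Acyclic.

(** * Weak proregularity and regularity under change of rings and modules *)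

Lemma exprD_sqr0 (A : comPzRingType) k (a d : A) :
  d * d = 0 -> (a + d) ^+ k.+1 = a ^+ k * (a + k.+1%:R * d).
Proof.
move=> dd; elim: k => [|k IH]; first by rewrite expr0 !mul1r expr1.
rewrite exprS IH.
have -> : (a + d) * (a ^+ k * (a + k.+1%:R * d))
  = a ^+ k.+1 * (a + (k.+1%:R + 1) * d) + a ^+ k * k.+1%:R * (d * d).
  by rewrite exprS; ring.
by rewrite dd mulr0 addr0 natr1.
Qed.

Section KoszulFactor.
Variables (A : comPzRingType) (N : lmodType A) (I : Type).
Implicit Types (f g : I -> A) (s : seq I).

Lemma koszul_map_comp (x : seq A) l m n (le_nl : (n <= l)%N) (le_lm : (l <= m)%N)
    (le_nm : (n <= m)%N) i c :
  koszul_map N le_nl x i (koszul_map N le_lm x i c) = koszul_map N le_nm x i c.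
Proof.
elim: x i c => [|a x IH] [|i] c //=; first exact: IH.
rewrite /ktm_S /= IH (linearZ_LR (koszul_map N le_nl x i)) IH scalerA -exprD.
by congr (_, _ ^+ _ *: _); lia.
Qed.

(** When the transition maps of [f] factor through those of [g] on each element of
    the sequence, they do so on the tensor product. *)
Lemma koszul_map_factor f g m n m' n' (le_nm : (n <= m)%N)
    (le_nm' : (n' <= m')%N) s :
    (forall t, exists u v, [/\ f t ^+ m = u * g t ^+ m', g t ^+ n' = v * f t ^+ n
       & v * g t ^+ (m' - n') * u = f t ^+ (m - n)]) ->
  exists F : chain_map (koszul N (seq_pow (map f s) m))
                       (koszul N (seq_pow (map g s) m')),
  exists G : chain_map (koszul N (seq_pow (map g s) n'))
                       (koszul N (seq_pow (map f s) n)),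
  forall i c, G i (koszul_map N le_nm' (map g s) i (F i c))
              = koszul_map N le_nm (map f s) i c.
Proof.
move=> fg; elim: s => [|t s [F [G FG]]].
  by exists (chain_id _), (chain_id _).
have [u [v [fu gv uv]]] := fg t.
exists (koszul_tensor_map fu F), (koszul_tensor_map gv G) => -[|i] c /=.
  exact: FG.
rewrite /ktm_S /= FG; congr pair; rewrite -uv -FG.
rewrite (linearZ_LR (koszul_map _ _ _ _)) /= !(linearZ_LR (G i)) /= !scalerA.
by rewrite mulrA.
Qed.

(** By [exprD_sqr0], [(f t) ^ (m + 1)] is a multiple of [(g t) ^ m] and
    [(g t) ^ (n + 1)] one of [(f t) ^ n], so the transition map from [m + 1] to [n]
    for [f] factors through the one from [m] to [n + 1] for [g]. *)
Lemma weakly_proregular_sqr0 f g s :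
    (forall t, (f t - g t) ^+ 2 = 0) ->
  weakly_proregular N (map g s) -> weakly_proregular N (map f s).
Proof.
move=> fg /weakly_proregularP wg; apply/weakly_proregularP => n.
have [m [le_nm wm]] := wg n.+1; exists m.+1.
have le_nm1 : (n <= m.+1)%N by lia.
exists le_nm1 => i c dc.
have [|F [G FG]] := @koszul_map_factor f g m.+1 n m n.+1 le_nm1 le_nm s.
  move=> t; set e := f t - g t.
  have ee : e * e = 0 by have := fg t; rewrite expr2.
  have fE : f t = g t + e by rewrite addrC subrK.
  exists (g t + m.+1%:R * e), (f t + n.+1%:R * - e); split.
  - by rewrite fE exprD_sqr0 // mulrC.
  - have -> : g t = f t + - e by rewrite fE addrK.
    by rewrite exprD_sqr0 ?mulrNN // mulrC.
  - have -> : (m.+1 - n = (m - n.+1).+2)%N by lia.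
    have -> : m.+1%:R = ((m - n.+1).+2)%:R + n%:R :> A.
      by rewrite -natrD; congr (_%:R); lia.
    (* The product of the two cofactors at exponents [m] and [n + 1] is the
       right one because the terms in [e ^ 2] vanish. *)
    set q := (m - n.+1)%N; set r := q.+2%:R; rewrite fE exprD_sqr0 // -natr1 exprS -/r.
    set b := g t ^+ q.
    have -> : (g t + e + (n%:R + 1) * - e) * b * (g t + (r + n%:R) * e)
      = g t * b * (g t + r * e) - b * n%:R * (r + n%:R) * (e * e) by ring.
    by rewrite ee mulr0 subr0.
have [|b db] := wm i (F i.+1 c); first by rewrite ch_mapC dc linear0.
by exists (G i.+2 b); rewrite ch_mapC db FG.
Qed.

End KoszulFactor.

Section Semilinear.
Variables (I : Type) (A A' : comPzRingType) (N : lmodType A) (N' : lmodType A').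
Variables (g : I -> A) (g' : I -> A') (f : {additive N -> N'}).
Hypothesis fg : forall t n, f (g t *: n) = g' t *: f n.
Implicit Types s : seq I.

Lemma seq_mul_semilinear s n :
  n \in seq_mul (map g s) N -> f n \in seq_mul (map g' s) N'.
Proof.
elim: s n => [|t s IH] n; first by move/seq_mul_nil->; rewrite raddf0 rpred0.
case/seq_mul_cons=> n' /IH h; apply/seq_mul_cons; exists (f n').
by rewrite -fg -raddfB.
Qed.

(** [seq_pow] is applied to [map g s], and not the power map composed with [g]
    mapped over [s], so that [koszul_map] applies without transport. *)
Fixpoint koszul_semilin m s i :
    koszul N (seq_pow (map g s) m) i -> koszul N' (seq_pow (map g' s) m) i :=
  match s with
  | [::] => match i with 0 => f | _ => fun=> 0 end
  | t :: s' =>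
    match i with
    | 0 => @koszul_semilin m s' 0%N
    | j.+1 => fun c => (koszul_semilin c.1, koszul_semilin c.2)
    end
  end.

Lemma koszul_semilinB m s i : zmod_morphism (@koszul_semilin m s i).
Proof.
elim: s i => [|t s IH] [|i] c d /=.
- exact: raddfB.
- by rewrite subr0.
- exact: IH.
- by rewrite !IH.
Qed.

Lemma koszul_semilinX m t s i k c :
  koszul_semilin (g t ^+ k *: c) = g' t ^+ k *: @koszul_semilin m s i c.
Proof.
elim: s i c => [|t' s IH] [|i] c //=.
- by elim: k => [|k IHk]; rewrite ?scale1r // !exprS -!scalerA fg IHk.
- by rewrite scaler0.
- by rewrite !IH.
Qed.

HB.instance Definition _ m s i :=
  GRing.isZmodMorphism.Build _ _ (@koszul_semilin m s i) (@koszul_semilinB m s i).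

Lemma koszul_semilinC m s i c :
  ch_d (koszul N' (seq_pow (map g' s) m)) i (koszul_semilin c)
  = koszul_semilin (ch_d (koszul N (seq_pow (map g s) m)) i c).
Proof.
elim: s i c => [|t s IH] [|i] c //=.
- by rewrite raddf0.
- by rewrite /kt_d0 /= IH raddfD /= koszul_semilinX.
- by rewrite /kt_dS /= IH raddfD raddfN /= IH koszul_semilinX.
Qed.

Lemma koszul_semilin_map m n (le_nm : (n <= m)%N) s i c :
  koszul_map N' le_nm (map g' s) i (koszul_semilin c)
  = koszul_semilin (koszul_map N le_nm (map g s) i c).
Proof.
elim: s i c => [|t s IH] [|i] c //=.
- exact: IH.
- by rewrite /ktm_S /= !IH koszul_semilinX.
Qed.

Lemma koszul_semilin_inj m s i : injective f -> injective (@koszul_semilin m s i).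
Proof.
move=> fI; elim: s i => [|t s IH] [|i] c d /=.
- exact: fI.
- by move=> _; apply/rowP; case.
- exact: IH.
- by case: c d => [u v] [u' v'] [/IH-> /IH->].
Qed.

End Semilinear.

Section Summand.
Variables (I : Type) (A A' : comPzRingType) (N : lmodType A) (N' : lmodType A').
Variables (g : I -> A) (g' : I -> A').
Variables (f : {additive N -> N'}) (f' : {additive N' -> N}).
Hypotheses (fg : forall t n, f (g t *: n) = g' t *: f n).
Hypotheses (fg' : forall t n, f' (g' t *: n) = g t *: f' n).

Lemma koszul_semilinK m s i : cancel f f' ->
  cancel (@koszul_semilin _ _ _ _ _ g g' f m s i) (@koszul_semilin _ _ _ _ _ g' g f' m s i).
Proof.
move=> fK; elim: s i => [|t s IH] [|i] c /=.
- exact: fK.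
- by apply/rowP; case.
- exact: IH.
- by case: c => u v; rewrite !IH.
Qed.

Lemma weakly_proregular_summand (s : seq I) : cancel f f' ->
  weakly_proregular N' (map g' s) -> weakly_proregular N (map g s).
Proof.
move=> fK /weakly_proregularP w; apply/weakly_proregularP => n.
have [m [le_nm wm]] := w n; exists m, le_nm => i c dc.
have [|e de] := wm i (koszul_semilin g' f c).
  by rewrite (koszul_semilinC fg) dc raddf0.
exists (koszul_semilin g f' e); rewrite (koszul_semilinC fg') de (koszul_semilin_map fg).
exact: koszul_semilinK.
Qed.

Lemma weak_regular_summand (s : seq I) : cancel f f' ->
  weak_regular_seq N' (map g' s) -> weak_regular_seq N (map g s).
Proof.
move=> fK; elim/last_ind: s => [|s t IH]; first by move=> _ [].
rewrite !map_rcons !weak_regular_rcons => -[/IH ws wt]; split=> // n tn.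
rewrite -(fK n); apply/(seq_mul_semilinear fg')/wt.
by rewrite -fg; apply: (seq_mul_semilinear fg).
Qed.

End Summand.

Section Extension.
Variables (I : Type) (A A1 A2 : comPzRingType).
Variables (N : lmodType A) (N1 : lmodType A1) (N2 : lmodType A2).
Variables (g : I -> A) (g1 : I -> A1) (g2 : I -> A2).
Variables (f1 : {additive N1 -> N}) (f2 : {additive N -> N2}).
Hypotheses (fg1 : forall t n, f1 (g1 t *: n) = g t *: f1 n).
Hypotheses (fg2 : forall t n, f2 (g t *: n) = g2 t *: f2 n).
Hypotheses (f1I : injective f1) (f2S : forall n, exists n', f2 n' = n).
Hypothesis f12 : forall n, f2 n = 0 <-> exists n', f1 n' = n.

Lemma koszul_semilin_surj m s i c : exists c', @koszul_semilin _ _ _ _ _ g g2 f2 m s i c' = c.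
Proof.
elim: s i c => [|t s IH] [|i] c /=.
- exact: f2S.
- by exists 0; apply/rowP; case.
- exact: IH.
- by case: c => u v; have [[u' <-] [v' <-]] := (IH _ u, IH _ v); exists (u', v').
Qed.

Lemma koszul_semilin_exact m s i c : @koszul_semilin _ _ _ _ _ g g2 f2 m s i c = 0 ->
  exists c', @koszul_semilin _ _ _ _ _ g1 g f1 m s i c' = c.
Proof.
elim: s i c => [|t s IH] [|i] c /=.
- by move/f12.
- by exists 0; apply/rowP; case.
- exact: IH.
- by case: c => u v [/IH[u' <-] /IH[v' <-]]; exists (u', v').
Qed.

(** The transition map from [m] to [k] kills homology on the quotient, which moves
    a cycle into the submodule up to a boundary; there the map from [k] to [n]
    kills it. *)
Lemma weakly_proregular_extension (s : seq I) :
  weakly_proregular N1 (map g1 s) -> weakly_proregular N2 (map g2 s) ->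
  weakly_proregular N (map g s).
Proof.
move=> /weakly_proregularP w1 /weakly_proregularP w2.
apply/weakly_proregularP => n.
have [k [le_nk wk]] := w1 n; have [m [le_km wm]] := w2 k.
have le_nm := leq_trans le_nk le_km; exists m, le_nm => i c dc.
have [|e de] := wm i (koszul_semilin g2 f2 c).
  by rewrite (koszul_semilinC fg2) dc raddf0.
have [e' ee] := koszul_semilin_surj e; move: de; rewrite -ee.
rewrite (koszul_semilinC fg2) (koszul_semilin_map fg2) => /eqP.
rewrite eq_sym -subr_eq0 -raddfB => /eqP/koszul_semilin_exact[c1 c1E].
have [|e1 de1] := wk i c1.
  apply: (koszul_semilin_inj (g' := g) f1I); rewrite raddf0 -(koszul_semilinC fg1) /= c1E.
  by rewrite linearB ch_dd subr0 ch_mapC dc linear0.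
exists (koszul_semilin g f1 e1 + koszul_map N le_nk (map g s) i.+2 e').
rewrite linearD (koszul_semilinC fg1) de1 -(koszul_semilin_map fg1) c1E ch_mapC.
by rewrite linearB subrK koszul_map_comp.
Qed.

Lemma seq_mul_lift (s : seq I) n : n \in seq_mul (map g2 s) N2 ->
  exists2 n', n' \in seq_mul (map g s) N & f2 n' = n.
Proof.
elim: s n => [|t s IH] n /=.
  by move/seq_mul_nil->; exists 0; rewrite ?rpred0 ?raddf0.
case/seq_mul_cons=> n2 /IH[n' sn' n'E]; have [m mE] := f2S n2.
exists (n' + g t *: m); last by rewrite raddfD fg2 mE n'E subrK.
by apply/seq_mul_cons; exists m; rewrite addrK.
Qed.

Lemma seq_mul_mod_sub (s : seq I) n : f2 n \in seq_mul (map g2 s) N2 ->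
  exists n1, n - f1 n1 \in seq_mul (map g s) N.
Proof.
case/seq_mul_lift=> n' sn' /esym/eqP; rewrite -subr_eq0 -raddfB => /eqP/f12[n1 n1E].
by exists n1; rewrite n1E opprB addrC subrK.
Qed.

(** [N1 / x N1 -> N / x N] is injective because the relations between the elements
    of a weakly regular sequence on [N2] are trivial: the coefficient [n'] of the
    last element lies, modulo [N1], in the submodule generated by the others. *)
Lemma seq_mul_restrict (s : seq I) n : weak_regular_seq N2 (map g2 s) ->
  f1 n \in seq_mul (map g s) N -> n \in seq_mul (map g1 s) N1.
Proof.
elim/last_ind: s n => [|s t IH] n.
  move=> _ /seq_mul_nil; rewrite -[0 in RHS](raddf0 f1) => /f1I->.
  exact: rpred0.
rewrite !map_rcons => /weak_regular_rcons[ws wt] /seq_mul_rcons[n' sn'].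
have f20 m : f2 (f1 m) = 0 by apply/f12; exists m.
have /wt/seq_mul_mod_sub[n1 sn1] : g2 t *: f2 n' \in seq_mul (map g2 s) N2.
  have := seq_mul_semilinear fg2 sn'; rewrite raddfB f20 sub0r fg2.
  by rewrite rpredN.
apply/seq_mul_rcons; exists n1; apply: IH => //.
rewrite raddfB fg1.
have := rpredD sn' (rpredZ (g t) sn1).
by rewrite scalerBr addrA subrK.
Qed.

(** Modulo [x N], an element killed by the next one vanishes in [N2], so it comes
    from [N1]; its multiple there vanishes modulo [x N], hence modulo [x N1] by
    [seq_mul_restrict]. *)
Lemma weak_regular_extension (s : seq I) :
  weak_regular_seq N1 (map g1 s) -> weak_regular_seq N2 (map g2 s) ->
  weak_regular_seq N (map g s).
Proof.
elim/last_ind: s => [|s t IH]; first by move=> _ _ [].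
rewrite !map_rcons !weak_regular_rcons => -[ws1 wt1] [ws2 wt2].
split=> [|n tn]; first exact: IH.
have /wt2/seq_mul_mod_sub[n1 sn1] : g2 t *: f2 n \in seq_mul (map g2 s) N2.
  by rewrite -fg2; apply: (seq_mul_semilinear fg2).
rewrite -(subrK (f1 n1) n) rpredD //; apply/(seq_mul_semilinear fg1)/wt1.
apply: seq_mul_restrict => //; rewrite fg1.
have := rpredB tn (rpredZ (g t) sn1).
by rewrite scalerBr opprB addrC subrK.
Qed.

End Extension.

(** * Top Čech cohomology *)

Lemma frac_zero (A : comPzRingType) (S : mulrClosed A) (H : lmodType A)
  (t : denom S) : frac (0 : H) t = 0.
Proof. by rewrite -[X in frac X _](scale0r 0) -frac_scale scale0r. Qed.

Lemma mloc_neq0 (A : comPzRingType) (S : mulrClosed A) (H : lmodType A) :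
  nonzero_module (mloc S H) <-> exists h : H, forall s, s \in S -> s *: h <> 0.
Proof.
split=> [[v]|[h hS]].
  case: (mlocP v) => h t ht; exists h => s sS sh; apply: ht; rewrite -(frac_zero _ t).
  apply/frac_eq; exists (Denom sS) => /=.
  by rewrite scaler0 mulrC -scalerA sh scaler0.
exists (frac h (denom1 S)); rewrite -(frac_zero _ (denom1 S)) => /frac_eq[u] /=.
by rewrite scaler0 mulr1; apply: hS; apply: denomP.
Qed.

Lemma in_supportP (A : comPzRingType) (p : prime_ideal A) (x : seq A) :
  in_support (quot_seq A^o x) p <-> {subset x <= prime_pred p}.
Proof.
rewrite /in_support /localization_at mloc_neq0; split=> [[h hp] a ax|xp].
  apply/negPn/negP => pa; apply: (hp a pa).
  rewrite -[h]quot_repr -linearZ.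
  by apply/quot_pi_eq0/seq_mul_gen.
exists (quot_pi _ (1 : A^o)) => s ps; rewrite -linearZ.
move=> /quot_pi_eq0; rewrite [_ *: _]mulr1 => sx.
move/negP: ps; apply.
apply: (@seq_mul_ind A A^o x (fun n : A => n \in prime_pred p) _ _ _ s sx).
- exact: prime0.
- by move=> u v; apply: primeD.
- by move=> a n /xp pa; rewrite [a *: n]mulrC; apply: primeM.
Qed.

Section Cech.
Variable A : comPzRingType.
Implicit Types (a : A) (C : cochain_complex A).

Fact pow_powers a k : a ^+ k \in powers a.
Proof. by apply/asboolP; exists k. Qed.
Definition pow_denom a k : denom (powers a) := Denom (pow_powers a k).

Lemma frac_powP (H : lmodType A) a (v : mloc (powers a) H) :
  exists c k, v = frac c (pow_denom a k).
Proof.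
case: (mlocP v) => c s; have /asboolP[k ks] := denomP s.
by exists c, k; congr frac; apply: val_inj.
Qed.

(** In the last degree, a fraction [c / a ^ k] bounds when it agrees with some
    [c'] up to boundaries of [C], which is seen after clearing denominators. *)
Lemma cech_coboundary C a j (c : C j) k :
    (forall u : C j.+1, u = 0) ->
  (((0, frac c (pow_denom a k)) : cech_tensor a C j.+1) \in
      @coboundaries _ (cech_tensor a C) j.+1) <->
  exists t c', a ^+ t *: c - a ^+ (t + k) *: c' \in @coboundaries _ C j.
Proof.
move=> C0; split=> [/asboolP[b /(congr1 snd) /=]|[t [c']]].
- case: j c C0 b => [|j] c C0 b /=.
    move/frac_eq=> [w] /=; have /asboolP[t ->] := denomP w => e.
    by exists t, b; rewrite exprD e mulr1 subrr; apply/eqP.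
  case: b => u v /=; have [e [r ->]] := frac_powP v.
  rewrite mloc_mapE => /eqP; rewrite subr_eq eq_sym frac_add => /eqP/frac_eq[w] /=.
  have /asboolP[t ->] := denomP w => E.
  exists (t + r)%N, u; apply/asboolP; exists (- (a ^+ (t + k) *: e)).
  rewrite linearN linearZ_LR /=; apply/eqP; rewrite eqr_oppLR opprB eq_sym subr_eq.
  apply/eqP; move: E; rewrite mulr1 scalerDr !scalerA -!exprD => E.
  by rewrite addrC E; congr (_ ^+ _ *: _); lia.
- case: j c c' C0 => [|j] c c' C0; [move=> /eqP E | move=> /asboolP[e E]].
    apply/asboolP; exists c'; congr pair; first exact: C0.
    apply/frac_eq; exists (pow_denom a t) => /=; rewrite mulr1 -exprD.
    by apply/eqP; rewrite eq_sym -subr_eq0; apply/eqP.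
  apply/asboolP; exists (c', - frac e (pow_denom a (t + k))).
  congr pair; first exact: C0.
  rewrite -[LHS]/(frac c' _ - mloc_map _ (- frac e (pow_denom a (t + k)))).
  rewrite (raddfN (mloc_map _)) opprK.
  rewrite [X in _ + X]mloc_mapE frac_add E; apply/frac_eq.
  exists (denom1 _) => /=; rewrite ?mul1r ?scale1r addrC subrK.
  by rewrite !scalerA -!exprD; congr (_ ^+ _ *: _); lia.
Qed.

End Cech.

Section CechTop.
Variables (A : comPzRingType) (N : lmodType A).
Implicit Types (a : A) (x : seq A) (n : N).

Lemma cech_above x i (c : cech N x i) : (size x < i)%N -> c = 0.
Proof.
elim: x i c => [|a x IH] [|i] //= c; first by move=> _; apply/rowP; case.
case: c => u v xi; congr pair; first by apply: IH; lia.
by case: (mlocP v) => n s; rewrite (IH _ n) // frac_zero.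
Qed.

(** The top degree is the iterated localization of [N]; this is the fraction
    [n / (x_1 ... x_l) ^ k] in it. *)
Fixpoint cech_top x k n : cech N x (size x) :=
  if x is a :: y then (0, frac (cech_top y k n) (pow_denom a k)) else n.

Lemma cech_top_linear x k : linear (cech_top x k).
Proof.
elim: x => //= a x IH b n n'; rewrite IH; apply: injective_projections.
  by rewrite /= scaler0 addr0.
exact: frac_linear.
Qed.
HB.instance Definition _ x k :=
  GRing.isLinear.Build A N (cech N x (size x)) *:%R (cech_top x k)
    (cech_top_linear x k).

Lemma cech_topZ x k a n : cech_top x k (a *: n) = a *: cech_top x k n.
Proof. exact: linearZ_LR. Qed.

Lemma cech_top_raise x k t n :
  cech_top x k n = cech_top x (k + t) ((\prod_(a <- x) a) ^+ t *: n).
Proof.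
elim: x n => [|a x IH] n /=; first by rewrite big_nil expr1n scale1r.
rewrite big_cons exprMn -scalerA cech_topZ -IH; congr pair.
apply/frac_eq; exists (denom1 _) => /=.
by rewrite !mul1r scalerA exprD.
Qed.

Lemma cech_top_surj x c : exists k n, cech_top x k n = c.
Proof.
elim: x c => [|a x IH] c; first by exists 0%N, c.
case: c => u v; have [c [r ->]] := frac_powP v; have [k [n <-]] := IH c.
exists (k + r)%N, (a ^+ k *: ((\prod_(b <- x) b) ^+ r *: n)).
apply: injective_projections; first exact/esym/cech_above.
rewrite /= cech_topZ -cech_top_raise; apply/frac_eq; exists (denom1 _) => /=.
by rewrite !mul1r scalerA exprD mulrC.
Qed.

Lemma seq_mul_prod x m t n : n \in seq_mul (seq_pow x m) N ->
  (\prod_(a <- x) a) ^+ t *: n \in seq_mul (seq_pow x (m + t)) N.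
Proof.
apply: (@seq_mul_ind _ _ _ (fun n => _ *: n \in seq_mul _ N)) => [|u v hu hv|b {}n].
- by rewrite scaler0 rpred0.
- by rewrite scalerDr rpredD.
- case/mapP=> a ax ->; rewrite (big_rem a ax) /= exprMn scalerA mulrAC -exprD addnC.
  by rewrite -scalerA seq_mul_gen //; apply/mapP; exists a.
Qed.

(** This identifies the top Čech cohomology with the direct limit of the modules
    [N / (x_1 ^ k, ..., x_l ^ k) N] along multiplication by [x_1 ... x_l]. *)
Lemma cech_top_coboundary x k n :
  cech_top x k n \in @coboundaries _ (cech N x) (size x) <->
  exists t, (\prod_(a <- x) a) ^+ t *: n \in seq_mul (seq_pow x (t + k)) N.
Proof.
elim: x k n => [|a x IH] k n.
  rewrite big_nil; split=> [/eqP /= ->|[t /seq_mul_nil]].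
    by exists 0%N; rewrite scaler0 rpred0.
  by rewrite expr1n scale1r => ->; apply/eqP.
have x0 (u : cech N x (size x).+1) : u = 0 by apply: cech_above.
have coB := cech_coboundary a (cech_top x k n) k x0.
rewrite big_cons; split=> [/coB[t [c]]|].
  have [k' [n' <-]] := cech_top_surj c.
  rewrite (cech_top_raise x k k') (cech_top_raise x k' k) (addnC k').
  rewrite -!cech_topZ -linearB => /IH[t' h]; exists (t + t' + k')%N.
  apply/seq_mul_cons.
  exists ((\prod_(b <- x) b) ^+ (t + t' + k) *: n').
  have -> : (t + t' + k' + k = t' + (k + k') + t)%N by lia.
  move/(seq_mul_prod t)/(rpredZ (a ^+ (t' + k'))): h; rewrite !scalerBr !scalerA !mulrA.
  set p := \prod_(b <- x) b.
  have -> : a ^+ (t' + k') * p ^+ t * p ^+ t' * a ^+ t * p ^+ k'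
    = (a * p) ^+ (t + t' + k') by rewrite exprMn !exprD; ring.
  have -> // : a ^+ (t' + k') * p ^+ t * p ^+ t' * a ^+ (t + k) * p ^+ k
    = a ^+ (t' + (k + k') + t) * p ^+ (t + t' + k) by rewrite !exprD; ring.
case=> t /seq_mul_cons[n' h]; apply/coB.
exists t, (cech_top x (k + t) n').
rewrite (cech_top_raise x k t) -!cech_topZ -linearB; apply/IH.
exists 0%N; rewrite scale1r add0n scalerA -exprMn (addnC k); exact: h.
Qed.

Lemma cech_cohomology_neq0 (p : prime_ideal A) x :
  nonzero_module (localization_at p (cech_cohomology N x (size x))) <->
  exists n k, forall s t, s \notin prime_pred p ->
    (\prod_(a <- x) a) ^+ t *: (s *: n) \notin seq_mul (seq_pow x (t + k)) N.
Proof.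
rewrite /localization_at mloc_neq0.
have q0 s z : s *: quot_pi (sub_pred (@cocycles _ (cech N x) (size x))
      (@coboundaries _ (cech N x) (size x))) z = 0 <->
    s *: submod_val z \in @coboundaries _ (cech N x) (size x).
  by rewrite -linearZ quot_pi_eq0.
split=> [[h hp]|[n [k nk]]].
  move: hp; rewrite -[h]quot_repr; set z := repr _ => hp.
  have [k [n nz]] := cech_top_surj (submod_val z).
  exists n, k => s t ps; apply/negP => snt; apply: (hp s ps); apply/q0.
  by rewrite -nz -cech_topZ; apply/cech_top_coboundary; exists t.
have cZ : cech_top x k n \in @cocycles _ (cech N x) (size x).
  by apply/eqP/cech_above.
exists (quot_pi _ (Submod cZ)) => s ps /q0; rewrite -cech_topZ.
by case/cech_top_coboundary=> t; apply/negP/nk.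
Qed.

End CechTop.

(** * Parameter sequences *)

Lemma seq_pow1 (A : comPzRingType) (x : seq A) : seq_pow x 1 = x.
Proof. by rewrite /seq_pow -[RHS]map_id; apply: eq_map => a; rewrite expr1. Qed.

(** A nonzero class at [p] is [n / (x_1 ... x_l)], where [n] is nonzero in the
    localization of [N / x N]: by the colon formula, an [s] that kills the class
    sends [n] into [xN]. *)
Lemma weak_regular_parameter_seq (A : comPzRingType) (N : lmodType A) (x : seq A) :
  weak_regular_seq N x -> seq_mul_proper N x -> parameter_seq N x.
Proof.
move=> /weak_regular_koszul_acyclic xA xp; right; split=> //.
  exact: koszul_acyclic_weakly_proregular.
move=> p; rewrite /in_support /localization_at mloc_neq0 => -[h hp].
apply/cech_cohomology_neq0.
exists (repr (h : Quotient.quot _)), 1%N => s t ps; apply/negP.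
move/(koszul_acyclic_colon xA); rewrite seq_pow1 => sn.
apply: (hp s ps); rewrite -[h]quot_repr -linearZ.
exact/quot_pi_eq0.
Qed.

Lemma regular_strong_parameter_seq (A : comPzRingType) (N : lmodType A) (x : seq A) :
  regular_seq N x -> strong_parameter_seq N x.
Proof.
case=> [-> [|i]|[wx [n nx]] i _] //; apply: weak_regular_parameter_seq.
  exact: weak_regular_take.
exists n; apply: contra nx; apply: seq_mul_mono => a; exact: mem_take.
Qed.

(** For a ring the unit is the universal class: a multiplier killing [1] kills the
    class of every fraction with the same denominator. *)
Lemma cech_cohomology_ring_neq0 (A : comPzRingType) (p : prime_ideal A) (x : seq A) :
  nonzero_module (localization_at p (cech_cohomology A^o x (size x))) <->
  exists k, forall s t, s \notin prime_pred p ->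
    (\prod_(a <- x) a) ^+ t * s \notin seq_mul (seq_pow x (t + k)) A^o.
Proof.
rewrite cech_cohomology_neq0; split=> [[n [k nk]]|[k kP]].
  exists k => s t /(nk s t); apply: contra => st.
  have -> : (\prod_(a <- x) a) ^+ t *: (s *: n) =
            n *: ((\prod_(a <- x) a) ^+ t * s : A^o).
    by rewrite /GRing.scale /=; ring.
  exact: rpredZ.
exists 1, k => s t /(kP s t).
by rewrite /GRing.scale /= mulr1.
Qed.

Lemma seq_mul_proper_ring (A : comPzRingType) (x : seq A) :
  seq_mul_proper A^o x <-> (1 : A^o) \notin seq_mul x A^o.
Proof.
split=> [[n]|]; last by exists 1.
apply: contra => x1; have -> : n = n *: (1 : A^o) by rewrite [RHS]mulr1.
exact: rpredZ.
Qed.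

Section Comap.
Variables (A B : comPzRingType) (h : {rmorphism A -> B}) (p : prime_ideal B).

Definition comap_pred : {pred A} := fun a => h a \in prime_pred p.

Definition comap_prime : prime_ideal A.
Proof.
apply: (@PrimeIdeal A comap_pred); rewrite /comap_pred.
- by rewrite unfold_in rmorph0 prime0.
- by move=> a b ap bp; rewrite unfold_in rmorphD; apply: primeD.
- by move=> a b bp; rewrite unfold_in rmorphM; apply: primeM.
- by rewrite unfold_in rmorph1 prime1.
- by move=> a b; rewrite !unfold_in rmorphM; apply: primeP.
Defined.

End Comap.

(** * The trivial extension *)

Section TrivialExtensionTransfer.
Variables (R : comPzRingType) (M : lmodType R).
Implicit Types (r : R) (m : M) (s : R ⋉ M).

Definition te_proj s : R := s.1.
Definition te_snd s : M := s.2.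
Definition te_in r : R ⋉ M := (r, 0).
Definition te_ideal m : R ⋉ M := (0, m).

Fact te_proj_zmod : zmod_morphism te_proj. Proof. by []. Qed.
Fact te_proj_monoid : monoid_morphism te_proj. Proof. by []. Qed.
Fact te_snd_zmod : zmod_morphism te_snd. Proof. by []. Qed.
Fact te_in_zmod : zmod_morphism te_in.
Proof. by move=> r r'; congr pair; rewrite /= subr0. Qed.
Fact te_in_monoid : monoid_morphism te_in.
Proof. by split=> // r r'; congr pair; rewrite /= !scaler0 addr0. Qed.
Fact te_ideal_zmod : zmod_morphism te_ideal.
Proof. by move=> m m'; congr pair; rewrite /= subr0. Qed.

HB.instance Definition _ := GRing.isZmodMorphism.Build _ _ te_proj te_proj_zmod.
HB.instance Definition _ := GRing.isMonoidMorphism.Build _ _ te_proj te_proj_monoid.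
HB.instance Definition _ := GRing.isZmodMorphism.Build _ _ te_snd te_snd_zmod.
HB.instance Definition _ := GRing.isZmodMorphism.Build _ _ te_in te_in_zmod.
HB.instance Definition _ := GRing.isMonoidMorphism.Build _ _ te_in te_in_monoid.
HB.instance Definition _ := GRing.isZmodMorphism.Build _ _ te_ideal te_ideal_zmod.

Let projA : {additive (R ⋉ M)^o -> R^o} := te_proj.
Let sndA : {additive (R ⋉ M)^o -> M} := te_snd.
Let inA : {additive R^o -> (R ⋉ M)^o} := te_in.
Let idealA : {additive M -> (R ⋉ M)^o} := te_ideal.

Lemma te_sqr0 s t : (s - te_in (te_proj s)) * (t - te_in (te_proj t)) = 0.
Proof.
apply: injective_projections => /=; first by rewrite subrr mul0r.
by rewrite !subrr !scale0r addr0.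
Qed.

Let projM (s : R ⋉ M) (t : (R ⋉ M)^o) : projA (s *: t) = te_proj s *: projA t.
Proof. by []. Qed.
Let idealM s m : idealA (te_proj s *: m) = s *: idealA m.
Proof. by apply: injective_projections; rewrite /= ?mulr0 // scale0r addr0. Qed.
Let ideal_inj : injective idealA. Proof. by move=> m m' []. Qed.
Let proj_surj r : exists s, projA s = r. Proof. by exists (inA r). Qed.
Let proj_ker (s : (R ⋉ M)^o) : projA s = 0 <-> exists m, idealA m = s.
Proof. by split=> [s0|[m <-]] //; exists s.2; case: s s0 => r m /= ->. Qed.

Lemma te_weakly_proregular (z : seq (R ⋉ M)) :
  weakly_proregular R^o (map te_proj z) -> weakly_proregular M (map te_proj z) ->
  weakly_proregular (R ⋉ M)^o z.
Proof.
move=> wR wM; rewrite -[z]map_id.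
exact: (weakly_proregular_extension (g := id) idealM projM ideal_inj proj_surj proj_ker).
Qed.

Lemma te_weakly_proregular_proj (z : seq (R ⋉ M)) :
  weakly_proregular (R ⋉ M)^o z -> weakly_proregular R^o (map te_proj z).
Proof.
rewrite -{1}[z]map_id => wz.
have {}wz : weakly_proregular (R ⋉ M)^o (map (te_in \o te_proj) z).
  apply: weakly_proregular_sqr0 wz => s /=.
  by rewrite -[_ - _]opprB sqrrN expr2 te_sqr0.
apply: (weakly_proregular_summand (f := inA) (f' := projA)) wz => // s r.
exact: (rmorphM te_in).
Qed.

Lemma te_weak_regular (z : seq (R ⋉ M)) :
  weak_regular_seq M (map te_proj z) -> weak_regular_seq R^o (map te_proj z) ->
  weak_regular_seq (R ⋉ M)^o z.
Proof.
move=> wM wR; rewrite -[z]map_id.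
exact: (weak_regular_extension (g := id) idealM projM ideal_inj proj_surj proj_ker).
Qed.

Lemma te_weak_regular_in (x : seq R) : weak_regular_seq (R ⋉ M)^o (map te_in x) ->
  weak_regular_seq R^o x /\ weak_regular_seq M x.
Proof.
move=> wx; rewrite -[x]map_id; split.
  apply: (weak_regular_summand (f := inA) (f' := projA)) wx => //.
  by move=> r s; apply: (rmorphM te_in).
apply: (weak_regular_summand (f := idealA) (f' := sndA)) wx => //.
  by move=> r m; rewrite -idealM.
by move=> r s; rewrite /sndA /= /te_snd /= scaler0 addr0.
Qed.

Lemma te_seq_mul_proper (z : seq (R ⋉ M)) :
  seq_mul_proper (R ⋉ M)^o z <-> seq_mul_proper R^o (map te_proj z).
Proof.
rewrite !seq_mul_proper_ring; split; apply: contra.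
  move/(seq_mul_lift (g := id) projM proj_surj) => [s]; rewrite map_id => sz s1.
  (* [s] is a unit, as its image under the projection is 1. *)
  have -> : (1 : (R ⋉ M)^o) = ((1, - s.2) : R ⋉ M) *: s; last exact: rpredZ.
  case: s s1 {sz} => r m /= ->.
  by apply: injective_projections; rewrite /= ?mulr1 // !scale1r addrN.
by rewrite -[z in seq_mul z]map_id; apply: (seq_mul_semilinear (f := projA)).
Qed.

(** Primes contain the square-zero ideal, and so are determined by their trace
    on [R]. *)
Lemma te_prime (P : prime_ideal (R ⋉ M)) s :
  (te_in (te_proj s) \in prime_pred P) = (s \in prime_pred P).
Proof.
have nP : s - te_in (te_proj s) \in prime_pred P.
  have := prime0 P; rewrite -(te_sqr0 s s).
  by move/primeP; rewrite orbb.
apply/idP/idP => h; first by rewrite -(subrK (te_in (te_proj s)) s) primeD.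
rewrite -[te_in _](subKr s) primeD //.
by rewrite -mulN1r primeM.
Qed.

(** A relation over [R] is carried to [ι (π z)], not to [z].  Powers of [s] and of
    [ι (π s)] divide each other only up to a loss of one in the exponent; as this
    is used in both directions, [k] is shifted by 2. *)
Lemma te_cech_proj (p : prime_ideal R) (z : seq (R ⋉ M)) :
  nonzero_module (localization_at (comap_prime te_proj p)
    (cech_cohomology (R ⋉ M)^o z (size z))) ->
  nonzero_module (localization_at p
    (cech_cohomology R^o (map te_proj z) (size (map te_proj z)))).
Proof.
rewrite !cech_cohomology_ring_neq0 => -[k kP]; exists k.+2 => r t pr.
apply: contra (kP (te_in r) t.+1 pr) => zr.
have pow1 (s : R ⋉ M) j : exists u, s ^+ j.+1 = te_in (te_proj s) ^+ j * u.
  exists (te_in (te_proj s) + j.+1%:R * (s - te_in (te_proj s))).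
  by rewrite -exprD_sqr0 ?te_sqr0 // [_ + (_ - _)]addrC subrK.
have pow2 (s : R ⋉ M) j : exists u, te_in (te_proj s) ^+ j.+1 = s ^+ j * u.
  exists (s + j.+1%:R * (te_in (te_proj s) - s)).
  rewrite -exprD_sqr0; first by rewrite [_ + (_ - _)]addrC subrK.
  by rewrite -[te_in _ - s]opprB mulrNN te_sqr0.
have [u ->] : exists u, (\prod_(s <- z) s) ^+ t.+1
    = u * te_in (\prod_(a <- map te_proj z) a) ^+ t.
  elim: z {kP zr} => [|s z [u IH]].
    by exists 1; rewrite !big_nil rmorph1 !expr1n mul1r.
  have [v sv] := pow1 s t; exists (u * v).
  rewrite /= !big_cons exprMn IH sv rmorphM exprMn.
  by rewrite [_ * v]mulrC mulrACA [v * u]mulrC.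
rewrite -mulrA -rmorphXn -rmorphM; apply: rpredZ.
have -> // : inA ((\prod_(a <- map te_proj z) a) ^+ t * r) \in
  seq_mul (seq_pow z (t.+1 + k)) (R ⋉ M)^o.
apply: seq_mul_map zr => _ n /mapP[_ /mapP[s sz ->] ->].
have -> : (t + k.+2 = (t.+1 + k).+1)%N by lia.
have [v sv] := pow2 s (t.+1 + k)%N.
have -> : inA (te_proj s ^+ (t.+1 + k).+1 *: n) = s ^+ (t.+1 + k) *: (v * inA n : (R ⋉ M)^o).
  by rewrite -[RHS]/(_ * _) mulrA -sv -(rmorphXn te_in); apply: (rmorphM te_in).
by apply/seq_mul_gen/map_f.
Qed.

Lemma te_cech_in (P : prime_ideal (R ⋉ M)) (z : seq (R ⋉ M)) :
  nonzero_module (localization_at (comap_prime te_in P)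
    (cech_cohomology R^o (map te_proj z) (size (map te_proj z)))) ->
  nonzero_module (localization_at P
    (cech_cohomology (R ⋉ M)^o z (size z))).
Proof.
rewrite !cech_cohomology_ring_neq0 => -[k kP]; exists k => s t Ps.
have {}Ps : te_proj s \notin prime_pred (comap_prime te_in P).
  by rewrite -te_prime in Ps.
apply: contra (kP (te_proj s) t Ps) => zs.
rewrite (big_map te_proj) -(rmorph_prod te_proj) -(rmorphXn te_proj).
rewrite -(rmorphM te_proj) /seq_pow -map_comp.
apply: (seq_mul_semilinear (f := projA) (g := fun s => s ^+ (t + k))) zs.
by move=> a b; rewrite /= -(rmorphXn te_proj).
Qed.

Lemma te_parameter_seq (wpr : forall x : seq R,
    weakly_proregular R^o x -> weakly_proregular M x) (z : seq (R ⋉ M)) :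
  parameter_seq (R ⋉ M)^o z <-> parameter_seq R^o (map te_proj z).
Proof.
split=> -[z0|[zw /te_seq_mul_proper zp zH]]; [left|right|left|right].
- by rewrite z0.
- split=> // [|p]; first exact: te_weakly_proregular_proj.
  move/in_supportP => zp'; apply/te_cech_proj/zH/in_supportP => s sz.
  by apply: zp'; apply: map_f.
- by case: z z0.
- split=> // [|P]; first by apply: te_weakly_proregular => //; apply: wpr.
  move/in_supportP => zP; apply/te_cech_in/zH/in_supportP => _ /mapP[s sz ->].
  by have := zP s sz; rewrite -te_prime.
Qed.

Lemma te_strong_parameter_seq (wpr : forall x : seq R,
    weakly_proregular R^o x -> weakly_proregular M x) (z : seq (R ⋉ M)) :
  strong_parameter_seq (R ⋉ M)^o z <-> strong_parameter_seq R^o (map te_proj z).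
Proof.
split=> sz i; have := sz i; rewrite size_map -map_take => zi /zi;
  by rewrite te_parameter_seq.
Qed.

End TrivialExtensionTransfer.

Theorem theorem4p11 (R : comPzRingType) (M : lmodType R)
    (wpr : forall x : seq R, weakly_proregular R^o x -> weakly_proregular M x) :
  cohen_macaulay_ring (R ⋉ M) <->
  cohen_macaulay_ring R /\
  (forall x : seq R, regular_seq R^o x -> weak_regular_seq M x).
Proof.
have projK x : map (@te_proj R M) (map (@te_in R M) x) = x.
  by rewrite -map_comp map_id.
split=> [cmS|[cmR RM] z].
  have reg x : strong_parameter_seq R^o x ->
      weak_regular_seq M x /\ regular_seq R^o x.
    (* The empty sequence is regular by convention, even over the zero ring. *)
    case: x => [|a x]; first by split; [case | left].
    set y := a :: x => sx; have : regular_seq (R ⋉ M)^o (map (@te_in R M) y).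
      by apply: cmS; apply/te_strong_parameter_seq; rewrite ?projK.
    case=> // -[/te_weak_regular_in[yR yM] /te_seq_mul_proper].
    by rewrite projK => yp; split=> //; right.
  split=> [x /reg[]|x] //.
  by move/regular_strong_parameter_seq/reg => [].
move/te_strong_parameter_seq => /(_ wpr)/cmR zR.
have zM := RM _ zR; case: zR => [z0|[zR zp]]; first by left; case: z z0 {zM}.
right; split; last exact/te_seq_mul_proper.
exact: te_weak_regular.
Qed.
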